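(* Define $$\Lambda_{0} := \begin{cases}\frac{\beta_1^2}{\beta_0} + 2 |\lambda| \beta_2 &\text{for the fully implicit method,} \\[4pt] \frac{\beta_1^2}{\beta_0} + 2 |\lambda|(1+ 2 \mu ) \beta_2 &\text{for the implicit-explicit (IMEX) method,}\end{cases}\qquad \mu:=\max_{2\leq n \leq N}\mu_{n},\qquad C_{0} := 2.$$ Assume $\Delta t:=\max_{1\le n\le N}\Delta t_n<\left(\frac{1}{2\Lambda_0\Gamma(2-\alpha)}\right)^{1/\alpha}$. Then the solution $u_h^n$ of the fully discrete problem $$u_h^0=P_hu_0,\qquad (D^{\alpha}_{t_n}u_h^n, v_h) + a(t_n;u_h^n,v_h) = \lambda(\mathcal{I}(Eu_h^n),v_h) +(f^n,v_h) \quad \forall v_h \in S_h,\ 1\leq n \leq N,$$ satisfies $$\|u_h^n\| \leq 2C_{0} E_{\alpha}(2 \Lambda_{0} t_n^{\alpha})\left( \|u_h^0\| + \max_{1\leq j \leq n} \sum_{i=1}^jP_{\alpha}^{j,i}\|f^i\|\right), \quad 1 \leq n \leq N.$$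
   Context: **Setting.** $0<\alpha<1$, $0<T<\infty$, $J=(0,T]$, $\lambda\in\mathbb{R}$; $\Omega\subset\mathbb{R}^d$ ($d=1,2,3$) is a bounded convex polygonal or polyhedral domain. $\|\cdot\|$, $(\cdot,\cdot)$ are the $L^2(\Omega)$ norm and inner product, $\|\cdot\|_1$ the $H^1(\Omega)$ norm. $\mathcal{I}\phi(\boldsymbol{x})=\int_\Omega \phi(\boldsymbol{y})g(\boldsymbol{x},\boldsymbol{y})\,d\boldsymbol{y}$ with $g\in L^\infty(\Omega\times\Omega)$, and $\beta_2$ is a constant with $\|\mathcal I\phi\|\le\beta_2\|\phi\|$ for $\phi\in L^2(\Omega)$. The data are $u_0$ and $f$, with $f^n=f(\cdot,t_n)\in L^2(\Omega)$. **Bilinear forms.** $a=a_0+a_1$ with $a_0(t;\phi,\psi)=(\boldsymbol A(\cdot,t)\nabla\phi,\nabla\psi)$ and $a_1(t;\phi,\psi)=(\boldsymbol b(\cdot,t)\cdot\nabla\phi+c(\cdot,t)\phi,\psi)$ on $H_0^1(\Omega)$, where $\boldsymbol A$ is symmetric, uniformly positive definite and bounded on $\Omega\times J$, and $\boldsymbol b$, $c$, $\partial_t\boldsymbol A$ are bounded. Constants $\beta_0,\beta_1>0$ satisfy $a_0(t;\phi,\phi)\ge\beta_0\|\phi\|_1^2$ and $|a_1(t;\phi,\psi)|\le\beta_1\|\phi\|_1\|\psi\|$ for all $\phi,\psi\in H_0^1(\Omega)$ and $t\in J$. **Discretization.** $N>1$, $\gamma\ge1$, $t_n=(n/N)^\gamma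 T$, $\Delta t_n=t_n-t_{n-1}$, $\mu_n=\Delta t_n/\Delta t_{n-1}$ ($2\le n\le N$). $S_h$ is a finite-dimensional (finite element) subspace of $H_0^1(\Omega)$ and $P_h:L^2(\Omega)\to S_h$ is the $L^2$-projection. With $k_\beta(t)=t^{\beta-1}/\Gamma(\beta)$ and $K^{n,j}_{1-\alpha}=\frac1{\Delta t_j}\int_{t_{j-1}}^{t_j}k_{1-\alpha}(t_n-s)\,ds$, the L1 operator is $D_{t_n}^\alpha\phi^n=\sum_{j=1}^nK^{n,j}_{1-\alpha}(\phi^j-\phi^{j-1})$. The extrapolation operator is: $E\phi^n=\phi^n$ (fully implicit method), or $E\phi^1=\phi^0$ and $E\phi^n=(1+\mu_n)\phi^{n-1}-\mu_n\phi^{n-2}$ for $n\ge2$ (IMEX method). The complementary kernels are $P_\alpha^{n,n}=1/K^{n,n}_{1-\alpha}$ and $P_\alpha^{n,i}=\frac{1}{K^{i,i}_{1-\alpha}}\sum_{j=i+1}^nP_\alpha^{n,j}(K^{j,i+1}_{1-\alpha}-K^{j,i}_{1-\alpha})$ for $1\le i\le n-1$. $E_\alpha(z)=\sum_{j\ge0}z^j/\Gamma(j\alpha+1)$ is the Mittag-Leffler function. *)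

(* Defs.v *)
From HB Require Import structures.
From mathcomp Require Import all_boot all_order all_algebra.
From mathcomp Require Import all_classical all_reals all_analysis.
Set Implicit Arguments.
Unset Strict Implicit.
Unset Printing Implicit Defensive.
Import Order.TTheory GRing.Theory Num.Theory.
Import numFieldNormedType.Exports.
Local Open Scope classical_set_scope.
Local Open Scope ring_scope.

(* R^d is 'rV[R]_d, for its normed-module structure. The library has no
   sigma-algebra on it: as for n.-tuple, we take the one generated by the
   coordinates. *)
Definition measure_row_display : measure_display. Proof. exact. Qed.

Section measurable_row.
Variables (R : realType) (d : nat).

Definition row_coord (i : 'I_d) (x : 'rV[R]_d) : measurableTypeR R := x ord0 i.

Let row_set0 : g_sigma_preimage row_coord set0.
Proof. exact: sigma_algebra0. Qed.

Let row_setC A : g_sigma_preimage row_coord A -> g_sigma_preimage row_coord (~` A).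
Proof. exact: sigma_algebraC. Qed.

Let row_bigcup (F : (set 'rV[R]_d)^nat) :
  (forall i, g_sigma_preimage row_coord (F i)) ->
  g_sigma_preimage row_coord (\bigcup_i (F i)).
Proof. exact: sigma_algebra_bigcup. Qed.

HB.instance Definition _ := @isMeasurable.Build measure_row_display
  'rV[R]_d (g_sigma_preimage row_coord) row_set0 row_setC row_bigcup.

End measurable_row.

Section lebesgue_row.
Variable R : realType.

Lemma measurable_row_coord d (i : 'I_d) :
  measurable_fun [set: 'rV[R]_d] (@row_coord R d i).
Proof.
move=> _ Y mY; rewrite setTI; apply: sub_sigma_algebra => /=.
rewrite -bigcup_seq/=; exists i => /=; first by rewrite mem_index_enum.
by exists Y => //; rewrite setTI.
Qed.

Lemma measurable_fun_rowP d' (T : measurableType d') n (f : T -> 'rV[R]_n) :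
  (forall i, measurable_fun [set: T] (@row_coord R n i \o f)) ->
  measurable_fun [set: T] f.
Proof.
move=> mf; suff : g_sigma_preimage (fun i => @row_coord R n i \o f) `<=`
    measurable.
  rewrite g_sigma_preimage_comp => prefS _ A mA.
  by apply: prefS; exists A.
apply: smallest_sub; first exact: sigma_algebra_measurable.
rewrite -bigcup_seq => A [i _] [B mB <-].
exact: mf.
Qed.

Definition consr n (z : measurableTypeR R * 'rV[R]_n) : 'rV[R]_n.+1 :=
  row_mx (z.1%:M : 'rV[R]_1) z.2.

Definition unconsr n (x : 'rV[R]_n.+1) : measurableTypeR R * 'rV[R]_n :=
  (x ord0 ord0, \row_j x ord0 (lift ord0 j)).

Lemma consr0 n (z : measurableTypeR R * 'rV[R]_n) : consr z ord0 ord0 = z.1.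
Proof.
rewrite /consr (_ : ord0 = lshift n (@ord0 0)); last exact/val_inj.
by rewrite (row_mxEl (z.1%:M : 'rV[R]_1)) mxE.
Qed.

Lemma consrS n (z : measurableTypeR R * 'rV[R]_n) (j : 'I_n) :
  consr z ord0 (lift ord0 j) = z.2 ord0 j.
Proof.
rewrite /consr (_ : lift ord0 j = rshift 1 j); last exact/val_inj.
by rewrite (row_mxEr (z.1%:M : 'rV[R]_1)).
Qed.

Lemma consrK n : cancel (@consr n) (@unconsr n).
Proof.
move=> z; rewrite /unconsr consr0; case: z => a v /=; congr pair.
by apply/rowP => j; rewrite mxE consrS.
Qed.

Lemma measurable_consr n : measurable_fun setT (@consr n).
Proof.
apply: measurable_fun_rowP => i; case: (unliftP ord0 i) => [j|] ->.
- rewrite (_ : _ \o _ = @row_coord R n j \o snd); last first.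
    by apply/funext => z; exact: consrS.
  by apply: measurableT_comp => //; exact: measurable_row_coord.
- rewrite (_ : _ \o _ = fst); first exact: measurable_fst.
  by apply/funext => z; exact: consr0.
Qed.

Lemma measurable_unconsr n : measurable_fun setT (@unconsr n).
Proof.
apply: measurable_fun_pair; first exact: (@measurable_row_coord n.+1 ord0).
apply: measurable_fun_rowP => i.
rewrite (_ : _ \o _ = @row_coord R n.+1 (lift ord0 i)).
  exact: measurable_row_coord.
by apply/funext => x; rewrite /row_coord /= mxE.
Qed.

Section step.
Variables (n : nat) (m : {sigma_finite_measure set 'rV[R]_n -> \bar R}).

(* Lebesgue measure on R^(n+1) as the image of (Lebesgue on R) x m. *)
Definition leb_step : set 'rV[R]_n.+1 -> \bar R :=
  pushforward (@lebesgue_measure R \x m)%E (@consr n).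

Let M : {measure set 'rV[R]_n.+1 -> \bar R} :=
  measure_function_pushforward__canonical__measure_function_Measure
    (@lebesgue_measure R \x m)%E (@measurable_consr n).

Let leb_step0 : leb_step set0 = 0%E. Proof. exact: (measure0 M). Qed.
Let leb_step_ge0 A : (0 <= leb_step A)%E. Proof. exact: (measure_ge0 M). Qed.
Let leb_step_sigma_additive : semi_sigma_additive leb_step.
Proof. exact: (@measure_semi_sigma_additive _ _ _ M). Qed.

HB.instance Definition _ := isMeasure.Build _ _ _ leb_step
  leb_step0 leb_step_ge0 leb_step_sigma_additive.

Let leb_step_sigma_finite : sigma_finite setT leb_step.
Proof.
have /sigma_finiteP[F [TF ndF Foo]] := sigma_finiteT (@lebesgue_measure R).
have /sigma_finiteP[G [TG ndG Goo]] := sigma_finiteT m.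
exists (fun k => @unconsr n @^-1` (F k `*` G k)).
  rewrite -preimage_bigcup (_ : \bigcup_k _ = setT) ?preimage_setT//.
  rewrite -subTset => -[x y] _.
  have [i _ Fix] : (\bigcup_i F i) x by rewrite -TF.
  have [j _ Gjy] : (\bigcup_i G i) y by rewrite -TG.
  exists (maxn i j) => //; split.
  - by move: x Fix; exact/subsetPset/ndF/leq_maxl.
  - by move: y Gjy; exact/subsetPset/ndG/leq_maxr.
move=> k; have [mF Fk] := Foo k; have [mG Gk] := Goo k; split.
  rewrite -[X in measurable X]setTI; apply: measurable_unconsr => //.
  exact: measurableX.
rewrite /leb_step /pushforward -comp_preimage (_ : _ \o _ = id); last first.
  by apply/funext => z; exact: consrK.
by rewrite product_measure1E// lte_mul_pinfty// ge0_fin_numE.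
Qed.

HB.instance Definition _ := Measure_isSigmaFinite.Build _ _ _ leb_step
  leb_step_sigma_finite.

End step.

Fixpoint leb d : {sigma_finite_measure set 'rV[R]_d -> \bar R} :=
  if d is n.+1 then leb_step (leb n) else dirac (0 : 'rV[R]_0).

Lemma measurable_box d (a b : 'I_d -> R) :
  measurable [set x : 'rV[R]_d | forall i, x ord0 i \in `]a i, b i]].
Proof.
rewrite (_ : [set _ | _] =
    \bigcap_(i in [set: 'I_d]) (@row_coord R d i @^-1` `]a i, b i])).
  apply: fin_bigcap_measurable => // i _; rewrite -[X in measurable X]setTI.
  exact: measurable_row_coord.
by apply/seteqP; split => [x h i _|x h i]; [exact: h|exact: (h i I)].
Qed.

Lemma leb_box d (a b : 'I_d -> R) : (forall i, a i <= b i) ->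
  leb d [set x | forall i, x ord0 i \in `]a i, b i]] =
  (\prod_(i < d) (b i - a i))%:E.
Proof.
elim: d a b => [|d IH] a b ab.
  by rewrite big_ord0 /= diracE mem_set// => -[].
rewrite big_ord_recl EFinM -(IH _ _ (fun i => ab (lift ord0 i))) /=.
pose A := `]a ord0, b ord0]%classic.
pose B := [set x : 'rV[R]_d |
  forall i, x ord0 i \in `]a (lift ord0 i), b (lift ord0 i)]].
transitivity ((@lebesgue_measure R \x leb d)%E (A `*` B)).
  rewrite /leb_step /pushforward; congr (_ _).
  apply/seteqP; split => [z h|z [h0 h] i].
    by split => [|i /=]; [rewrite /A /= -consr0|rewrite -consrS]; exact: h.
  by case: (unliftP ord0 i) => [j|] ->; [rewrite consrS; exact: h|rewrite consr0].
have mA : measurable (A : set (measurableTypeR R)) by exact: measurable_itv.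
have mB : measurable B by exact: measurable_box.
rewrite (product_measure1E _ _ mA mB); congr (_ * _)%E.
move: (ab ord0); rewrite /A le_eqVlt => /orP[/eqP <-|altb].
  by rewrite set_itvoc0 measure0 subrr.
by rewrite [LHS]lebesgue_measure_itv /= lte_fin altb EFinB.
Qed.

End lebesgue_row.
Arguments leb {R} d.

Section sobolev.
Variables (R : realType) (d : nat).
Implicit Types (Omega : set 'rV[R]_d) (phi psi : 'rV[R]_d -> R)
  (G : 'rV[R]_d -> 'rV[R]_d) (S : set ('rV[R]_d -> R)).

Definition dotv (u v : 'rV[R]_d) : R := \sum_(i < d) u ord0 i * v ord0 i.

(* The interior of a convex polytope: an interval, polygon or polyhedron. *)
Definition convex_polytope_domain Omega :=
  [/\ Omega !=set0, bounded_set Omega &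
    exists m (nu : 'I_m -> 'rV[R]_d) (b : 'I_m -> R),
      Omega = [set x | forall k, dotv (nu k) x < b k]].

Definition L2fun Omega phi :=
  measurable_fun Omega phi /\
  (leb d).-integrable Omega (fun x => (phi x ^+ 2)%:E).

Definition L2ip Omega phi psi : R := \int[leb d]_(x in Omega) (phi x * psi x).

Definition L2norm Omega phi : R := Num.sqrt (L2ip Omega phi phi).

Definition partial (i : 'I_d) phi : 'rV[R]_d -> R :=
  fun x => 'D_(delta_mx ord0 i) phi x.

Definition smooth phi := forall s : seq 'I_d,
  continuous (foldr partial phi s) /\
  forall i x, derivable (foldr partial phi s) x (delta_mx ord0 i).

Definition test_fun Omega psi :=
  [/\ smooth psi, compact (closure [set x | psi x != 0]) &
      closure [set x | psi x != 0] `<=` Omega].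

Definition weak_grad Omega phi G := forall i : 'I_d,
  L2fun Omega (fun x => G x ord0 i) /\
  forall psi, test_fun Omega psi ->
    L2ip Omega phi (partial i psi) = - L2ip Omega (fun x => G x ord0 i) psi.

(* The weak gradient is determined up to a null set; wgrad chooses a
   representative. *)
Definition wgrad Omega phi : 'rV[R]_d -> 'rV[R]_d :=
  xget (fun=> 0) [set G | weak_grad Omega phi G].

Definition H1fun Omega phi :=
  L2fun Omega phi /\ exists G, weak_grad Omega phi G.

Definition H1norm Omega phi : R :=
  Num.sqrt (L2norm Omega phi ^+ 2 +
            \sum_(i < d) L2norm Omega (fun x => wgrad Omega phi x ord0 i) ^+ 2).

Definition H10fun Omega phi := H1fun Omega phi /\
  forall e : R, 0 < e ->
    exists2 psi, test_fun Omega psi & H1norm Omega (phi \- psi) < e.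

(* Functions are identified when they agree a.e. on Omega. *)
Definition fin_dim_subspace Omega S := S `<=` H10fun Omega /\
  exists m (e : 'I_m -> 'rV[R]_d -> R), (forall k, H10fun Omega (e k)) /\
    forall v, H10fun Omega v ->
      (S v <-> exists c : 'I_m -> R,
        {ae leb d, forall x, Omega x -> v x = \sum_(k < m) c k * e k x}).

Definition is_L2proj Omega S phi w :=
  S w /\ forall v, S v -> L2ip Omega w v = L2ip Omega phi v.

End sobolev.

Section forms.
Variables (R : realType) (d : nat) (Omega : set 'rV[R]_d).
Implicit Types phi psi : 'rV[R]_d -> R.

Definition bounded_coef (J : set R) (k : 'rV[R]_d -> R -> R) :=
  (forall t, J t -> measurable_fun Omega (k ^~ t)) /\
  exists M : R, forall x t, Omega x -> J t -> `|k x t| <= M.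

(* Gradients are rows, so the vector A * grad is the row grad *m A^T. *)
Definition a0form (A : 'rV[R]_d -> R -> 'M[R]_d) t phi psi : R :=
  \int[leb d]_(x in Omega)
    dotv (wgrad Omega phi x *m (A x t)^T) (wgrad Omega psi x).

Definition a1form (b : 'rV[R]_d -> R -> 'rV[R]_d) (c : 'rV[R]_d -> R -> R)
    t phi psi : R :=
  L2ip Omega (fun x => dotv (b x t) (wgrad Omega phi x) + c x t * phi x) psi.

Definition Iop (g : 'rV[R]_d -> 'rV[R]_d -> R) phi : 'rV[R]_d -> R :=
  fun x => \int[leb d]_(y in Omega) (phi y * g x y).

Definition Linfty2 (g : 'rV[R]_d -> 'rV[R]_d -> R) :=
  measurable_fun (Omega `*` Omega) (fun z => g z.1 z.2) /\
  exists M : R, {ae (leb d \x leb d)%E,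
    forall z, (Omega `*` Omega) z -> `|g z.1 z.2| <= M}.

End forms.

Section time_stepping.
Variable R : realType.
Implicit Types (alpha beta gamma T z : R) (t : nat -> R) (n i j N : nat).

Definition Gamma z : R :=
  \int[lebesgue_measure]_(s in `]0, +oo[) (s `^ (z - 1) * expR (- s)).

Definition mittag_leffler alpha z : R :=
  limn (series (fun j => z ^+ j / Gamma (j%:R * alpha + 1))).

Definition mesh T gamma N n : R := (n%:R / N%:R) `^ gamma * T.

Definition tstep t n : R := t n - t n.-1.

Definition tratio t n : R := tstep t n / tstep t n.-1.

(* Starting the iteration at F m makes this the maximum of F m, ..., F n
   whatever the signs of the values, for m <= n. *)
Definition max_from m n (F : nat -> R) : R :=
  \big[Num.max/F m]_(m <= i < n.+1) F i.

Definition kfun beta s : R := s `^ (beta - 1) / Gamma beta.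

Definition Kker alpha t n j : R :=
  (tstep t j)^-1 *
  \int[lebesgue_measure]_(s in `[t j.-1, t j]) kfun (1 - alpha) (t n - s).

Definition L1op alpha t (X : Type) (u : nat -> X -> R) n : X -> R :=
  fun x => \sum_(1 <= j < n.+1) Kker alpha t n j * (u j x - u j.-1 x).

Variant scheme := FullyImplicit | IMEX.

(* The value at n = 0 is never used. *)
Definition extrap (s : scheme) t (X : Type) (u : nat -> X -> R) n : X -> R :=
  match s with
  | FullyImplicit => u n
  | IMEX => if n is k.+2 then
              fun x => (1 + tratio t n) * u k.+1 x - tratio t n * u k x
            else u 0%N
  end.

(* The complementary kernels are defined by downward recursion on i; the fuel
   k bounds the depth n - i of the recursion. *)
Fixpoint Pker_rec alpha t n k i : R :=
  if k is k'.+1 then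
    if i == n then (Kker alpha t n n)^-1
    else (Kker alpha t i i)^-1 *
      \sum_(i.+1 <= j < n.+1)
        Pker_rec alpha t n k' j * (Kker alpha t j i.+1 - Kker alpha t j i)
  else 0.

Definition Pker alpha t n i : R := Pker_rec alpha t n (n - i).+1 i.

Lemma Pker_diag alpha t n : Pker alpha t n n = (Kker alpha t n n)^-1.
Proof. by rewrite /Pker /= eqxx. Qed.

Lemma PkerE alpha t n i : (i < n)%N ->
  Pker alpha t n i = (Kker alpha t i i)^-1 *
    \sum_(i.+1 <= j < n.+1)
      Pker alpha t n j * (Kker alpha t j i.+1 - Kker alpha t j i).
Proof.
have fuel k1 k2 j : (n - j < k1)%N -> (n - j < k2)%N -> (j <= n)%N ->
    Pker_rec alpha t n k1 j = Pker_rec alpha t n k2 j.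
  elim: k1 k2 j => [//|k1 IH] [//|k2] j h1 h2 jn /=.
  case: eqVneq => // jn'; congr (_ * _).
  have {jn'}jn : (j < n)%N by rewrite ltn_neqAle jn' jn.
  rewrite !big_nat; apply: eq_bigr => k /andP[jk kn]; congr (_ * _).
  have lt m : (n - j < m.+1)%N -> (n - k < m)%N.
    by rewrite ltnS; apply: leq_trans; exact: ltn_sub2l.
  by apply: IH => //; exact: lt.
move=> iltn; rewrite {1}/Pker /= (ltn_eqF iltn); congr (_ * _).
rewrite !big_nat; apply: eq_bigr => j /andP[ij jn]; congr (_ * _).
by apply: fuel => //; exact: ltn_sub2l.
Qed.

Definition Lambda0 (s : scheme) (beta0 beta1 beta2 lambda mu : R) : R :=
  beta1 ^+ 2 / beta0 +
  match s with
  | FullyImplicit => 2 * `|lambda| * beta2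
  | IMEX => 2 * `|lambda| * (1 + 2 * mu) * beta2
  end.

Definition C0 : R := 2.

End time_stepping.

(* Main.v *)
Require Import Defs.
From mathcomp Require Import all_boot all_order all_algebra.
From mathcomp Require Import all_classical all_reals all_analysis.
From mathcomp Require Import measurable_realfun.
From mathcomp Require Import ring lra zify.
Import Order.TTheory GRing.Theory Num.Theory.
Import numFieldNormedType.Exports.
Local Open Scope classical_set_scope.
Local Open Scope ring_scope.
Set Implicit Arguments.
Unset Strict Implicit.
Unset Printing Implicit Defensive.

(** Testing the scheme with the discrete solution itself turns the theorem into
    a scalar statement about y_n = ||u_h^n||.  Since the kernels K^{n,j} increase
    in j, Cauchy-Schwarz gives (D u^n, u^n) >= y_n D y_n [L1op_norm_le]; the form
    a loses at most (beta1^2 / (4 beta0)) y_n^2 by completing the square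
    [coercive_lower_bound]; and the nonlocal term is at most |lambda| beta2 y_n
    times the norm of the extrapolation.  Division by y_n gives
<<
      D y_n <= (Lambda0 / 2) max_{i <= n} y_i + ||f^n||.
>>
    The complementary kernels invert the L1 operator: sum_j P^{n,j} K^{j,i} = 1
    for every i [Pker_Kker], so
<<
      y_n <= y_0 + sum_j P^{n,j} ||f^j|| + (Lambda0 / 2) sum_j P^{n,j} max_{i <= j} y_i.
>>
    The step size condition says K^{n,n} >= 2 Lambda0, which absorbs a quarter of
    y_n into the left side.  For j < n the Mittag-Leffler function
    e_n = E_alpha(2 Lambda0 t_n^alpha) is a supersolution [Pker_mittag_leffler]:
<<
      sum_{j < n} P^{n,j} 2 Lambda0 e_j <= e_n - 1,
>>
    and induction on n [discrete_gronwall] gives y_n <= 2 G e_n, where G collects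
    the data; this is stronger than the bound to be proved by a factor two.

    The supersolution property is proved term by term.  With
    k_b(t) = t^{b-1} / Gamma(b), the general term of the series is
    (2 Lambda0)^m k_{m alpha + 1}(t_n), so what is needed is
<<
      sum_{j < n} P^{n,j} k_{c+1-alpha}(t_j) <= k_{c+1}(t_n)
>>
    with c = m alpha [Pker_kfun].  By the semigroup law
    k_c * k_{1-alpha} = k_{c+1-alpha} [kfun_conv] the left side is a sum of
    integrals of k_c(s) k_{1-alpha}(t_j - s) over mesh intervals.  On each of them
    the weight k_c is averaged out, by the Chebyshev integral inequality if k_c
    decreases and by its value at the right end point, paid for by the next and
    longer interval of the graded mesh, if k_c increases.

    Apart from the growth that makes the Mittag-Leffler series converge, all that is
    used of the Gamma function is the semigroup law, that is,
    Gamma(a) Gamma(b) = B(a, b) Gamma(a + b), which is proved by Tonelli's theorem;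
    with b = 1 it also integrates k_a and so evaluates K^{n,n}. *)

(** * Affine change of variable for the Lebesgue measure *)

Section substitution.
Context {R : realType}.
Local Notation mu := (@lebesgue_measure R).
Local Open Scope ereal_scope.

(** The image of the Lebesgue measure under an affine map is a multiple of it, by
    uniqueness on half-open intervals.  It is stated for measurable
    functions because the integrands below jump or blow up at end points. *)
Lemma ge0_integral_affine (f : R -> \bar R) (c b : R) : (0 < c)%R ->
  measurable_fun [set: R] f -> (forall x, 0 <= f x) ->
  \int[mu]_x f x = c%:E * \int[mu]_x f (c * x + b)%R.
Proof.
move=> c0 mf f0.
pose phi : R -> measurableTypeR R := fun x => (c * x + b)%R.
have mphi : measurable_fun [set: R] phi.
  by apply: measurable_funD => //; exact: measurable_funM.
have c0' : (0 <= c)%R by exact: ltW.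
pose nu : {measure set measurableTypeR R -> \bar R} :=
  mscale (NngNum c0') (measure_function_pushforward__canonical__measure_function_Measure mu mphi).
transitivity (\int[nu]_x f x).
  apply: eq_measure_integral => A mA _; apply: (lebesgue_measure_unique (mu := nu)) => //.
  move=> _ [[x y]] _ <-.
  rewrite /nu /= /mscale /= /pushforward.
  rewrite (_ : phi @^-1` _ = [set` (`](x - b) / c, (y - b) / c])%R]); last first.
    apply/seteqP; split => z /=; rewrite !in_itv /= /phi.
      by move=> /andP[h1 h2]; rewrite ltr_pdivrMr// ler_pdivlMr// mulrC; apply/andP; lra.
    by rewrite ltr_pdivrMr// ler_pdivlMr// mulrC => /andP[h1 h2]; apply/andP; lra.
  rewrite !lebesgue_measure_itv /= !lte_fin ltr_pM2r ?invr_gt0// ltrD2r.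
  case: ifPn => _; last by rewrite mule0.
  by rewrite -!EFinB -EFinM; congr EFin; field; exact: lt0r_neq0.
rewrite ge0_integral_mscale//=; congr (_ * _).
by rewrite ge0_integral_pushforward.
Qed.

End substitution.

(** * The Gamma function *)

Section gamma.
Context {R : realType}.
Local Notation mu := (@lebesgue_measure R).

Definition gamma_density (a s : R) : R := s `^ (a - 1) * expR (- s).

Lemma gamma_density_ge0 a s : 0 <= gamma_density a s.
Proof. by rewrite mulr_ge0// ?powR_ge0// expR_ge0. Qed.

Lemma measurable_gamma_density a : measurable_fun [set: R] (gamma_density a).
Proof.
apply: measurable_funM; first exact: measurable_powR.
by apply: measurableT_comp => //; exact: measurable_expR.
Qed.

(** The integral over [1/n, 1] is at most 1/a by the fundamental theorem of
    calculus, uniformly in n, and monotone convergence reaches the singularity at 0. *)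
Lemma integral_powR_lty (a : R) : 0 < a ->
  (\int[mu]_(s in `]0%R, 1%R]) (s `^ (a - 1))%:E < +oo)%E.
Proof.
move=> a0; pose F n : set R := `[(n.+2%:R)^-1, 1]%classic.
have ltF n : (n.+2%:R)^-1 < 1 :> R by rewrite invf_lt1 ?ltr1n// ltr0n.
have -> : [set` `]0, 1]] = \bigcup_n F n :> set R.
  apply/seteqP; split => [s|s [n _]] /=; rewrite !in_itv /=.
    move=> /andP[s0 s1]; exists (Num.truncn s^-1) => //; rewrite /F /= in_itv /= s1 andbT.
    rewrite -[leRHS]invrK lef_pV2 ?posrE ?invr_gt0// (le_trans (ltW (truncnS_gt _)))//.
    by rewrite ler_nat.
  by rewrite /F /= in_itv /= => /andP[h ->]; rewrite andbT (lt_le_trans _ h)// invr_gt0.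
have Fle n : (\int[mu]_(s in F n) (s `^ (a - 1))%:E <= (a^-1)%:E)%E.
  have ge0 s : (n.+2%:R)^-1 <= s -> 0 < s by apply: lt_le_trans; rewrite invr_gt0.
  rewrite (@continuous_FTC2 _ _ (fun s => a^-1 * s `^ a))//.
  - by rewrite powR1 mulr1 -EFinB lee_fin gerBl// mulr_ge0// ?powR_ge0// invr_ge0 ltW.
  - apply: continuous_in_subspaceT => s; rewrite inE /F /= in_itv /= => /andP[/ge0 s0 _].
    apply: differentiable_continuous; apply/derivable1_diffP.
    by apply: derivable_powR; rewrite in_itv /= s0.
  - have cF s : (n.+2%:R)^-1 <= s -> derivable (fun s => a^-1 * s `^ a) s 1.
      move=> /ge0 s0; apply: derivableM => //.
      by apply: derivable_powR; rewrite in_itv /= s0.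
    have cont s : (n.+2%:R)^-1 <= s -> {for s, continuous (fun s => a^-1 * s `^ a)}.
      by move=> /cF ds; apply: differentiable_continuous; exact/derivable1_diffP.
    split.
    + by move=> s; rewrite in_itv /= => /andP[/ltW /cF].
    + by apply: cvg_at_right_filter; exact: cont.
    + by apply: cvg_at_left_filter; exact/cont/ltW.
  - move=> s; rewrite in_itv /= => /andP[/ltW /ge0 s0 _].
    have ds := is_derive1_powR a s0.
    rewrite derive1E derive_val /GRing.scale /= mulrA mulVf ?mul1r// gt_eqF//.
have ndF : nondecreasing_seq F.
  move=> n m nm; rewrite subsetEset => s; rewrite /F /= !in_itv /= => /andP[h ->].
  by rewrite andbT (le_trans _ h)// lef_pV2 ?posrE// ler_nat.
have mF n : measurable_fun (F n) (fun s => (s `^ (a - 1))%:E).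
  by apply/measurable_EFinP; apply: measurable_funTS; exact: measurable_powR.
have F0 (n : nat) s : F n s -> (0 <= (s `^ (a - 1))%:E)%E by rewrite lee_fin powR_ge0.
have cvgF := @ge0_nondecreasing_set_cvg_integral _ (measurableTypeR R) R F _ mu
  ndF (fun=> measurable_itv _) mF F0.
apply: le_lt_trans (ltry (a^-1)); rewrite -(cvg_lim _ cvgF)//.
by apply: lime_le; [apply: cvgP cvgF | apply: nearW].
Qed.

(** Near 0 the density is dominated by the power of s, and at infinity by a
    multiple of the exponential density of rate 1/2. *)
Lemma integral_gamma_density_lty (a : R) : 0 < a ->
  (\int[mu]_(s in `]0%R, +oo[) (gamma_density a s)%:E < +oo)%E.
Proof.
move=> a0.
have mg D : measurable_fun D (fun s => (gamma_density a s)%:E).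
  by apply/measurable_EFinP; apply: measurable_funTS; exact: measurable_gamma_density.
have -> : `]0, +oo[%classic = `]0, 1] `|` `]1, +oo[ :> set R.
  by rewrite -itv_bndbnd_setU// bnd_simp.
rewrite ge0_integral_setU//=; last 3 first.
- exact: mg.
- by move=> s _; rewrite lee_fin gamma_density_ge0.
- by apply/disj_setPS => s [] /=; rewrite !in_itv /= => /andP[_ s1]; rewrite ltNge s1.
apply: lte_add_pinfty.
  apply: le_lt_trans (integral_powR_lty a0); apply: ge0_le_integral => //.
  - by move=> s _; rewrite lee_fin gamma_density_ge0.
  - exact: mg.
  - by apply/measurable_EFinP; apply: measurable_funTS; exact: measurable_powR.
  - move=> s /=; rewrite in_itv /= => /andP[s0 _].
    by rewrite lee_fin ler_piMr ?powR_ge0// -expR0 ler_expR oppr_le0 ltW.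
(* ln s <= ln K + s / K, and K is large enough for b * (s / K) <= s / 2: half of the
   exponential decay pays for the power, the other half remains integrable. *)
pose b : R := `|a - 1|; pose K : R := 2 * (b + 1); pose C := expR (b * ln K).
have b0 : 0 <= b by rewrite normr_ge0.
have K0 : 0 < K by rewrite /K; lra.
have h2 : 0 < 2^-1 :> R by rewrite invr_gt0.
have mp : measurable_fun setT (fun s => (exponential_pdf (2^-1) s)%:E : \bar R).
  by apply/measurable_EFinP; exact: measurable_exponential_pdf.
apply: (@le_lt_trans _ _ (\int[mu]_s ((2 * C)%:E * (exponential_pdf (2^-1) s)%:E))%E).
  apply: (@le_trans _ _
      (\int[mu]_(s in `]1%R, +oo[) ((2 * C)%:E * (exponential_pdf (2^-1) s)%:E))%E).
    apply: ge0_le_integral => //.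
    - by move=> s _; rewrite lee_fin gamma_density_ge0.
    - exact: mg.
    - by apply: emeasurable_funM => //; apply: measurable_funTS.
    - move=> s /=; rewrite in_itv /= andbT => s1.
      have s0 : 0 < s by lra.
      rewrite -EFinM lee_fin exponential_pdfE; last exact: ltW.
      rewrite /gamma_density.
      rewrite (_ : 2 * C * _ = C * expR (- 2^-1 * s)); last by field.
      rewrite /powR gt_eqF// -!expRD ler_expR.
      have lns : ln s <= ln K + s / K.
        have -> : ln s = ln K + ln (s / K).
          by rewrite ln_div ?posrE// addrC subrK.
        by rewrite lerD2l ltW// ln_sublinear// divr_gt0.
      have ln0 : 0 <= ln s by rewrite ln_ge0 // ltW.
      have h3 : (a - 1) * ln s <= b * ln s by rewrite ler_wpM2r// ler_norm.
      have h4 : b * ln s <= b * (ln K + s / K) by rewrite ler_wpM2l.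
      have h5 : b * (s / K) <= s / 2.
        rewrite mulrA ler_pdivrMr// /K; nra.
      lra.
  apply: ge0_subset_integral => //.
  - by apply: emeasurable_funM.
  - move=> s _; rewrite mule_ge0// lee_fin; first by rewrite mulr_ge0// expR_ge0.
    by rewrite exponential_pdf_ge0// ltW.
rewrite ge0_integralZl//=.
- by rewrite integral_exponential_pdf// mule1 ltry.
- by move=> s _; rewrite lee_fin exponential_pdf_ge0// ltW.
- by rewrite lee_fin mulr_ge0// expR_ge0.
Qed.

Lemma integral_gamma_densityE (a : R) : 0 < a ->
  (\int[mu]_(s in `]0%R, +oo[) (gamma_density a s)%:E = (Gamma a)%:E)%E.
Proof.
move=> a0; rewrite /Gamma /Rintegral fineK// ge0_fin_numE.
  exact: integral_gamma_density_lty.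
by apply: integral_ge0 => s _; rewrite lee_fin gamma_density_ge0.
Qed.

Lemma Gamma1 : Gamma 1 = 1 :> R.
Proof.
apply: EFin_inj; rewrite -integral_gamma_densityE//.
rewrite -(@integral_exponential_pdf R 1)// [RHS](_ : _ =
  (\int[mu]_(s in `[0%R, +oo[) (exponential_pdf 1 s)%:E)%E).
  rewrite -integral_itv_obnd_cbnd; last first.
    by apply/measurable_EFinP; apply: measurable_funTS; exact: measurable_exponential_pdf.
  apply: eq_integral => s; rewrite inE /= in_itv /= andbT => s0.
  by rewrite /gamma_density subrr powRr0 exponential_pdfE ?(ltW s0)// mulN1r.
rewrite [RHS]integral_mkcond; apply: eq_integral => s _.
rewrite patchE; case: ifPn => //; rewrite notin_setE /= in_itv /= andbT => /negP.
by rewrite -ltNge => /lt0_exponential_pdf ->.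
Qed.

(** Lower bounds on Gamma come from the unit interval [A, A + 1] alone. *)
Lemma Gamma_ge (a A m : R) : 0 < a -> 0 < A -> 0 <= m ->
  (forall s, A <= s <= A + 1 -> m <= s `^ (a - 1)) ->
  m * expR (- (A + 1)) <= Gamma a.
Proof.
move=> a0 A0 m0 hm; rewrite -lee_fin -integral_gamma_densityE//.
have mg D : measurable_fun D (fun s => (gamma_density a s)%:E).
  by apply/measurable_EFinP; apply: measurable_funTS; exact: measurable_gamma_density.
apply: (@le_trans _ _ (\int[mu]_(s in `[A, (A + 1)%R]) (gamma_density a s)%:E)%E); last first.
  apply: ge0_subset_integral => //.
  - exact: mg.
  - by move=> s _; rewrite lee_fin gamma_density_ge0.
  - by move=> s /=; rewrite !in_itv /= andbT => /andP[h _]; lra.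
have {1}-> : (m * expR (- (A + 1)))%:E =
    (\int[mu]_(s in `[A, (A + 1)%R]) (m * expR (- (A + 1)))%:E)%E.
  rewrite integral_cst//= lebesgue_measure_itv /= lte_fin ltrDl ltr01.
  by rewrite -EFinD -EFinM; congr EFin; ring.
apply: ge0_le_integral => //.
- by move=> s _; rewrite lee_fin mulr_ge0// expR_ge0.
- exact: mg.
- move=> s /=; rewrite in_itv /= => h; rewrite lee_fin ler_pM ?expR_ge0//.
    exact: hm.
  by rewrite ler_expR; lra.
Qed.

Lemma Gamma_gt0 (a : R) : 0 < a -> 0 < Gamma a.
Proof.
move=> a0; pose m := Num.min 1 ((1 + 1 : R) `^ (a - 1)).
have m0 : 0 < m by rewrite lt_min ltr01 powR_gt0.
apply: lt_le_trans (@Gamma_ge a 1 m a0 ltr01 (ltW m0) _).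
  by rewrite mulr_gt0// expR_gt0.
move=> s /andP[s1 s2]; rewrite /m ge_min; have [a1|a1] := leP 1 a.
  apply/orP; left; rewrite -[leLHS](congr1 (@^~ (a - 1)) (@powR1 R)) /=.
  by rewrite ge0_ler_powR ?nnegrE//; lra.
apply/orP; right.
rewrite -(opprK (a - 1)) !(powRN _ (- (a - 1))) lef_pV2 ?posrE ?powR_gt0//; try lra.
by rewrite ge0_ler_powR ?nnegrE//; lra.
Qed.

(** With A free, Gamma(x + 1) outgrows every geometric sequence in x; this is what
    makes the Mittag-Leffler series converge. *)
Lemma Gamma1p_ge (x A : R) : 0 <= x -> 0 < A ->
  A `^ x * expR (- (A + 1)) <= Gamma (x + 1).
Proof.
move=> x0 A0; apply: Gamma_ge; rewrite ?powR_ge0//; first lra.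
by move=> s /andP[As _]; rewrite addrK ge0_ler_powR ?nnegrE//; lra.
Qed.
End gamma.

(** * The semigroup of Riemann-Liouville kernels *)

Section convolution.
Context {R : realType}.
Local Notation mu := (@lebesgue_measure R).

(** The power function cut off at 0.  With it a convolution over ]0, t[ is an
    integral over the whole line, where Tonelli's theorem and affine changes of
    variable apply without side conditions on the domain. *)
Definition pospow (a x : R) : R := x `^ (a - 1) * \1_(`]0, +oo[%classic : set R) x.

Lemma pospowE a x : 0 < x -> pospow a x = x `^ (a - 1).
Proof. by move=> x0; rewrite /pospow indicE mem_set ?mulr1//= in_itv /= x0. Qed.

Lemma pospow_le0 a x : x <= 0 -> pospow a x = 0.
Proof.
by move=> x0; rewrite /pospow indicE memNset ?mulr0//= in_itv /= andbT ltNge x0.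
Qed.

Lemma pospow_ge0 a x : 0 <= pospow a x.
Proof. by rewrite mulr_ge0// powR_ge0. Qed.

Lemma pospowM a c x : 0 < c -> pospow a (c * x) = c `^ (a - 1) * pospow a x.
Proof.
move=> c0; have [x0|x0] := ltP 0 x; last first.
  by rewrite !pospow_le0 ?mulr0// pmulr_rle0.
by rewrite !pospowE ?mulr_gt0// powRM// ltW.
Qed.

Lemma measurable_pospow a : measurable_fun [set: R] (pospow a).
Proof. by apply: measurable_funM; [exact: measurable_powR|exact: measurable_indic]. Qed.

Lemma measurable_pospow_conv a b t :
  measurable_fun [set: R] (fun x => pospow a x * pospow b (t - x)).
Proof.
apply: measurable_funM; first exact: measurable_pospow.
by apply: measurableT_comp; [exact: measurable_pospow|exact: measurable_funB].
Qed.

Lemma integral_pospow_expR a : 0 < a ->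
  (\int[mu]_x (pospow a x * expR (- x))%:E = (Gamma a)%:E)%E.
Proof.
move=> a0; rewrite -integral_gamma_densityE// [RHS]integral_mkcond.
apply: eq_integral => x _; rewrite patchE; case: ifPn.
  by rewrite inE /= in_itv /= andbT => x0; rewrite pospowE.
rewrite notin_setE /= in_itv /= andbT => /negP; rewrite -leNgt => x0.
by rewrite pospow_le0// mul0r.
Qed.

(** Scaling by t reduces the convolution at t to the Beta integral. *)
Lemma integral_pospow_conv_scale a b t : 0 < t ->
  (\int[mu]_x (pospow a x * pospow b (t - x))%:E =
   (t `^ (a + b - 1))%:E * \int[mu]_x (pospow a x * pospow b (1 - x))%:E)%E.
Proof.
move=> t0; rewrite (@ge0_integral_affine _ _ t 0)//; last 2 first.
- by apply/measurable_EFinP; exact: measurable_pospow_conv.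
- by move=> x; rewrite lee_fin mulr_ge0// pospow_ge0.
rewrite -!ge0_integralZl//=.
- apply: eq_integral => x _; rewrite -!EFinM addr0; congr EFin.
  rewrite (_ : t - t * x = t * (1 - x)); last by ring.
  rewrite !pospowM//; set p := pospow _ _; set q := pospow _ _.
  rewrite (_ : a + b - 1 = 1 + (a - 1) + (b - 1)); last by ring.
  have tn : (t != 0) by rewrite gt_eqF.
  rewrite (@powRD _ t _ (b - 1)) ?tn ?implybT// (@powRD _ t 1) ?tn ?implybT//.
  by rewrite powRr1 ?(ltW t0)//; ring.
- by apply/measurable_EFinP; exact: measurable_pospow_conv.
- by move=> x _; rewrite lee_fin mulr_ge0// pospow_ge0.
- by rewrite lee_fin powR_ge0.
- apply/measurable_EFinP; apply: (measurableT_comp (measurable_pospow_conv a b t)).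
  by apply: measurable_funD => //; exact: measurable_funM.
- by move=> x _; rewrite lee_fin mulr_ge0// pospow_ge0.
- by rewrite lee_fin ltW.
Qed.

(** The Beta integral: the product Gamma(a) Gamma(b) is a double integral, in
    which the variable s = x + y separates the factor Gamma(a + b). *)
Lemma integral_pospow_conv1 a b : 0 < a -> 0 < b ->
  (\int[mu]_x (pospow a x * pospow b (1 - x))%:E =
   (Gamma a * Gamma b / Gamma (a + b))%:E)%E.
Proof.
move=> a0 b0; have ab0 : 0 < a + b by exact: addr_gt0.
set B := (\int[mu]_x _)%E.
have mexp : measurable_fun [set: R] (fun x : R => expR (- x)).
  by apply: measurableT_comp => //; exact: measurable_expR.
have mge c : measurable_fun [set: R] (fun x => (pospow c x * expR (- x))%:E).
  by apply/measurable_EFinP; apply: measurable_funM => //; exact: measurable_pospow.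
have ge0 c x : (0 <= (pospow c x * expR (- x))%:E)%E.
  by rewrite lee_fin mulr_ge0 ?pospow_ge0 ?expR_ge0.
have key : ((Gamma a * Gamma b)%:E = (Gamma (a + b))%:E * B)%E.
  rewrite EFinM -(integral_pospow_expR a0) -ge0_integralZr//=; last 2 first.
  - exact: mge.
  - by rewrite lee_fin ltW// Gamma_gt0.
  pose h (z : R * R) : \bar R :=
    ((pospow a z.1 * pospow b (z.2 - z.1)) * expR (- z.2))%:E.
  (* y is replaced by s - x in the inner integral. *)
  transitivity (\int[mu]_x \int[mu]_s h (x, s))%E.
    apply: eq_integral => x _.
    rewrite -(integral_pospow_expR b0) (@ge0_integral_affine _ _ 1 (- x))//.
    rewrite mul1e -ge0_integralZl//=.
    - apply: eq_integral => s _; rewrite mul1r /h -EFinM; congr EFin => /=.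
      rewrite (_ : - (s - x) = x - s); last by ring.
      rewrite (_ : expR (- s) = expR (- x) * expR (x - s)); last first.
        by rewrite -expRD; congr expR; ring.
      by ring.
    - apply: (measurableT_comp (mge b)).
      by apply: measurable_funD => //; exact: measurable_funM.
  have mh : measurable_fun setT h.
    apply/measurable_EFinP; apply: measurable_funM; last first.
      by apply: (measurableT_comp mexp); exact: measurable_snd.
    apply: measurable_funM.
      by apply: (measurableT_comp (measurable_pospow a)); exact: measurable_fst.
    apply: (measurableT_comp (measurable_pospow b)).
    by apply: measurable_funB; [exact: measurable_snd|exact: measurable_fst].
  rewrite fubini_tonelli//; last first.
    by move=> z; rewrite /h lee_fin mulr_ge0 ?expR_ge0// mulr_ge0 ?pospow_ge0.
  rewrite -(integral_pospow_expR ab0) -ge0_integralZr//=; last 2 first.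
  - exact: mge.
  - by apply: integral_ge0 => x _; rewrite lee_fin mulr_ge0 ?pospow_ge0.
  apply: eq_integral => s _.
  rewrite /h /=; under eq_integral do rewrite EFinM.
  rewrite ge0_integralZr//=; last 2 first.
  - by apply/measurable_EFinP; exact: measurable_pospow_conv.
  - by move=> x _; rewrite lee_fin mulr_ge0 ?pospow_ge0.
  have [s0|s0] := ltP 0 s.
    by rewrite integral_pospow_conv_scale// pospowE// EFinM muleAC.
  rewrite pospow_le0// mul0r mul0e integral0_eq ?mul0e// => x _.
  have [x0|x0] := leP x 0; first by rewrite (pospow_le0 _ x0) mul0r.
  by rewrite (@pospow_le0 b) ?mulr0//; lra.
have G0 := Gamma_gt0 ab0.
have B0 : (0 <= B)%E.
  by apply: integral_ge0 => x _; rewrite lee_fin mulr_ge0 ?pospow_ge0.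
move: B0 key; case: B => [r _| _|//].
  by rewrite -EFinM => -[->]; rewrite mulrAC mulfV ?mul1r// gt_eqF.
by rewrite gt0_muley ?lte_fin.
Qed.

(** The semigroup law of Riemann-Liouville kernels. *)
Lemma kfun_conv (a b t : R) : 0 < a -> 0 < b -> 0 < t ->
  (\int[mu]_(x in `]0%R, t[) (kfun a x * kfun b (t - x))%:E =
   (kfun (a + b) t)%:E)%E.
Proof.
move=> a0 b0 t0; have ab0 : 0 < a + b by exact: addr_gt0.
have Ga := Gamma_gt0 a0; have Gb := Gamma_gt0 b0; have Gab := Gamma_gt0 ab0.
have c0 : (0 <= ((Gamma a * Gamma b)^-1)%:E)%E.
  rewrite lee_fin; move: (Gamma a) (Gamma b) Ga Gb => x y x0 y0.
  by rewrite invr_ge0 mulr_ge0 ?(ltW x0) ?(ltW y0).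
transitivity (((Gamma a * Gamma b)^-1)%:E *
    \int[mu]_x (pospow a x * pospow b (t - x))%:E)%E.
  rewrite -ge0_integralZl//=.
  - rewrite integral_mkcond; apply: eq_integral => x _; rewrite patchE -EFinM.
    case: ifPn.
      rewrite inE /= in_itv /= => /andP[x0 xt].
      rewrite !pospowE ?subr_gt0// /kfun; congr EFin.
      by rewrite mulrACA invfM mulrC.
    rewrite notin_setE /= in_itv /= => /negP; rewrite negb_and -!leNgt => /orP[x0|tx].
      by rewrite (pospow_le0 _ x0) mul0r mulr0.
    by rewrite (@pospow_le0 b) ?mulr0// subr_le0.
  - by apply/measurable_EFinP; exact: measurable_pospow_conv.
  - by move=> x _; rewrite lee_fin mulr_ge0 ?pospow_ge0.
rewrite integral_pospow_conv_scale// integral_pospow_conv1// -!EFinM; congr EFin.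
rewrite /kfun; move: (t `^ _) (Gamma a) (Gamma b) (Gamma (a + b)) Ga Gb Gab.
by move=> p x y z x0 y0 z0; field; rewrite !gt_eqF.
Qed.

Lemma kfun1 (x : R) : kfun 1 x = 1.
Proof. by rewrite /kfun subrr powRr0 Gamma1 divr1. Qed.

Lemma integral_kfun (a t : R) : 0 < a -> 0 < t ->
  (\int[mu]_(x in `]0%R, t[) (kfun a x)%:E = (kfun (a + 1) t)%:E)%E.
Proof.
move=> a0 t0; rewrite -(kfun_conv a0 ltr01 t0); apply: eq_integral => x _.
by rewrite kfun1 mulr1.
Qed.
End convolution.

(** * Integrals of real functions and the Chebyshev inequality *)

Section integrable_real.
Context d (T : measurableType d) (R : realType) (m : {measure set T -> \bar R}).
Variables (D : set T) (mD : measurable D).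
Implicit Types (f g : T -> R).

Definition rintegrable f := m.-integrable D (EFin \o f).

Lemma rintegrableD f g : rintegrable f -> rintegrable g ->
  rintegrable (fun x => f x + g x).
Proof. by move=> hf hg; have := integrableD mD hf hg. Qed.

Lemma rintegrableZ c f : rintegrable f -> rintegrable (fun x => c * f x).
Proof. by move=> hf; have := integrableZl mD c hf. Qed.

Lemma rintegrable_le f g : measurable_fun D f ->
  (forall x, D x -> `|f x| <= g x) -> rintegrable g -> rintegrable f.
Proof.
move=> mf fg; apply: le_integrable => //; first exact/measurable_EFinP.
by move=> x Dx /=; rewrite lee_fin (le_trans (fg _ Dx))// ler_norm.
Qed.

Lemma rintegrable_cst c : (m D < +oo)%E -> rintegrable (fun=> c).
Proof.
move=> mDy; apply: measurable_bounded_integrable => //.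
exists `|c|; split; first exact: num_real.
by move=> M cM x _ /=; rewrite ltW.
Qed.

End integrable_real.

Section interval.
Context {R : realType}.
Local Notation mu := (@lebesgue_measure R).
Implicit Types (f g : R -> R) (x y : R).
Local Notation integrable_on x y f := (rintegrable mu `]x, y[ f).
Local Notation integral_on x y f := (\int[mu]_(s in `]x, y[) f s).

Lemma rintegrable_oitv_cst x y c : integrable_on x y (fun=> c).
Proof.
apply: rintegrable_cst => //=; rewrite lebesgue_measure_itv /=.
by case: ifP => _; rewrite ?ltry// -EFinB ltry.
Qed.

Lemma Rintegral_oitv_cst x y c : x <= y -> integral_on x y (fun=> c) = c * (y - x).
Proof.
move=> xy; rewrite Rintegral_cst//= lebesgue_measure_itv /= lte_fin.
by move: xy; rewrite le_eqVlt => /predU1P[->|->]//; rewrite ltxx subrr.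
Qed.

Lemma le_Rintegral_oitv x y f g : integrable_on x y f -> integrable_on x y g ->
  (forall s, x < s < y -> f s <= g s) -> integral_on x y f <= integral_on x y g.
Proof.
by move=> hf hg h; apply: le_Rintegral => // s; rewrite /= in_itv /=; exact: h.
Qed.

Lemma Rintegral_oitv_split x y z f : x <= y -> y < z -> integrable_on x z f ->
  integral_on x z f = integral_on x y f + integral_on y z f.
Proof.
move=> xy yz hf.
have E : `]x, z[%classic = `]x, y] `|` `]y, z[ :> set R.
  by rewrite -itv_bndbnd_setU// bnd_simp.
have hf' : mu.-integrable (`]x, y] `|` `]y, z[) (EFin \o f) by rewrite -E.
rewrite {1}E Rintegral_setU//=; last first.
  by apply/disj_setPS => s [] /=; rewrite !in_itv /= => /andP[_ s1]; rewrite ltNge s1.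
congr (_ + _); rewrite -Rintegral_itv_bndo_bndc//; apply: integrableS hf => //.
by apply: subset_itvl; rewrite bnd_simp ltW.
Qed.

Lemma rintegrable_oitvS x y x' y' f :
  x' <= x -> y <= y' -> integrable_on x' y' f -> integrable_on x y f.
Proof.
move=> xx yy; apply: integrableS => //; move=> s /=; rewrite !in_itv /= => /andP[a b].
by rewrite (le_lt_trans xx a) (lt_le_trans b yy).
Qed.

Lemma Rintegral_oitvD x y f g : integrable_on x y f -> integrable_on x y g ->
  integral_on x y (fun s => f s + g s) = integral_on x y f + integral_on x y g.
Proof. by move=> hf hg; rewrite RintegralD. Qed.

Lemma Rintegral_oitvB x y f g : integrable_on x y f -> integrable_on x y g ->
  integral_on x y (fun s => f s - g s) = integral_on x y f - integral_on x y g.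
Proof. by move=> hf hg; rewrite RintegralB. Qed.

Lemma Rintegral_oitvZ x y c f : integrable_on x y f ->
  integral_on x y (fun s => c * f s) = c * integral_on x y f.
Proof. by move=> hf; rewrite RintegralZl. Qed.

(** For r and s in the interval, (f s - f r) (g r - g s) is nonnegative because f
    and g vary in opposite directions.  It is integrated first in s with r fixed and
    then in r, so that only single integrals occur. *)
Lemma chebyshev_integral x y f g : x <= y ->
  integrable_on x y f -> integrable_on x y g -> integrable_on x y (fun s => f s * g s) ->
  (forall r s, x < r < y -> x < s < y -> r <= s -> f r <= f s /\ g s <= g r) ->
  (y - x) * integral_on x y (fun s => f s * g s) <= integral_on x y f * integral_on x y g.
Proof.
move=> xy hf hg hfg mono.
have Z c h : integrable_on x y h -> integrable_on x y (fun s => c * h s) by exact: rintegrableZ.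
have D h k : integrable_on x y h -> integrable_on x y k -> integrable_on x y (fun s => h s + k s).
  exact: rintegrableD.
have C c := rintegrable_oitv_cst x y c.
set F := integral_on x y f; set G := integral_on x y g.
set FG := integral_on x y (fun s => f s * g s).
have J r : x < r < y -> 0 <= (g r * F + f r * G) - (FG + (y - x) * (f r * g r)).
  move=> xry.
  have -> : (g r * F + f r * G) - (FG + (y - x) * (f r * g r)) =
      integral_on x y (fun s => (g r * f s + f r * g s) - (f s * g s + f r * g r)).
    rewrite Rintegral_oitvB; [|exact: D (Z _ _ hf) (Z _ _ hg)|exact: D hfg (C _)].
    rewrite (Rintegral_oitvD (Z _ _ hf) (Z _ _ hg)) (Rintegral_oitvD hfg (C _)).
    rewrite (Rintegral_oitvZ _ hf) (Rintegral_oitvZ _ hg) Rintegral_oitv_cst//.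
    by rewrite [(y - x) * _]mulrC.
  apply: Rintegral_ge0 => s /=; rewrite in_itv /= => xsy.
  rewrite (_ : _ - _ = (f s - f r) * (g r - g s)); last by ring.
  have [rs|/ltW sr] := leP r s.
    by have [? ?] := mono _ _ xry xsy rs; rewrite mulr_ge0// subr_ge0.
  by have [? ?] := mono _ _ xsy xry sr; rewrite mulr_le0// subr_le0.
have : 0 <= integral_on x y (fun r => (F * g r + G * f r) - (FG + (y - x) * (f r * g r))).
  apply: Rintegral_ge0 => r /=; rewrite in_itv /= => /J.
  by rewrite (mulrC F) (mulrC G).
rewrite Rintegral_oitvB; [|exact: D (Z _ _ hg) (Z _ _ hf)|exact: D (C _) (Z _ _ hfg)].
rewrite (Rintegral_oitvD (Z _ _ hg) (Z _ _ hf)) (Rintegral_oitvD (C _) (Z _ _ hfg)).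
rewrite (Rintegral_oitvZ _ hf) (Rintegral_oitvZ _ hg) Rintegral_oitv_cst// Rintegral_oitvZ//.
rewrite -/F -/G -/FG; lra.
Qed.

End interval.

(** * Kernels of the L1 scheme and their complementary kernels *)

Section riemann_liouville_kernel.
Context {R : realType}.
Local Notation mu := (@lebesgue_measure R).
Implicit Types (f g : R -> R) (x y u : R).
Local Notation integrable_on x y f := (rintegrable mu `]x, y[ f).
Local Notation integral_on x y f := (\int[mu]_(s in `]x, y[) f s).

Lemma measurable_kfun (b : R) : measurable_fun [set: R] (kfun b).
Proof. by apply: measurable_funM; [exact: measurable_powR|]. Qed.

Lemma kfun_ge0 (b x : R) : 0 < b -> 0 <= kfun b x.
Proof. by move=> b0; rewrite /kfun divr_ge0 ?powR_ge0// ltW// Gamma_gt0. Qed.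

Lemma kfun_le (b x y : R) : 1 <= b -> 0 <= x <= y -> kfun b x <= kfun b y.
Proof.
move=> b1 /andP[x0 xy]; rewrite /kfun ler_pM2r; last by rewrite invr_gt0 Gamma_gt0; lra.
by rewrite ge0_ler_powR ?nnegrE//; lra.
Qed.

Lemma kfun_ge (b x y : R) : 0 < b <= 1 -> 0 < x <= y -> kfun b y <= kfun b x.
Proof.
move=> /andP[b0 b1] /andP[x0 xy]; rewrite /kfun ler_pM2r ?invr_gt0 ?Gamma_gt0//.
rewrite -(opprK (b - 1)) !(powRN _ (- (b - 1))) lef_pV2 ?posrE ?powR_gt0//; try lra.
by rewrite ge0_ler_powR ?nnegrE//; lra.
Qed.

Lemma measurable_kfun_rev (b u : R) : measurable_fun [set: R] (fun s => kfun b (u - s)).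
Proof. by apply: (measurableT_comp (measurable_kfun b)); exact: measurable_funB. Qed.

Lemma measurable_kfun_conv (a b u : R) :
  measurable_fun [set: R] (fun s => kfun a s * kfun b (u - s)).
Proof. by apply: measurable_funM; [exact: measurable_kfun|exact: measurable_kfun_rev]. Qed.

Lemma rintegrable_kfun_conv (a b u : R) : 0 < a -> 0 < b -> 0 < u ->
  integrable_on 0 u (fun s => kfun a s * kfun b (u - s)).
Proof.
move=> a0 b0 u0; apply/integrableP; split.
  by apply/measurable_EFinP; apply: measurable_funTS; exact: measurable_kfun_conv.
apply: le_lt_trans (ltry (kfun (a + b) u)); rewrite -(kfun_conv a0 b0 u0).
rewrite le_eqVlt; apply/orP; left; apply/eqP; apply: eq_integral => s _ /=.
by rewrite ger0_norm// mulr_ge0 ?kfun_ge0.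
Qed.

Lemma Rintegral_kfun_conv (a b u : R) : 0 < a -> 0 < b -> 0 < u ->
  integral_on 0 u (fun s => kfun a s * kfun b (u - s)) = kfun (a + b) u.
Proof. by move=> a0 b0 u0; rewrite /Rintegral (kfun_conv a0 b0 u0). Qed.

Lemma rintegrable_kfun (a u : R) : 0 < a -> 0 < u -> integrable_on 0 u (kfun a).
Proof.
move=> a0 u0; have := rintegrable_kfun_conv a0 ltr01 u0.
by congr rintegrable; apply/funext => s; rewrite kfun1 mulr1.
Qed.

Lemma Rintegral_kfun (a u : R) : 0 < a -> 0 < u -> integral_on 0 u (kfun a) = kfun (a + 1) u.
Proof. by move=> a0 u0; rewrite /Rintegral integral_kfun. Qed.

Lemma rintegrable_kfun_rev (b u : R) : 0 < b -> 0 < u ->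
  integrable_on 0 u (fun s => kfun b (u - s)).
Proof.
move=> b0 u0; have := rintegrable_kfun_conv ltr01 b0 u0.
by congr rintegrable; apply/funext => s; rewrite kfun1 mul1r.
Qed.

(** A translation of ]x, u[ to ]0, u - x[ makes this a convolution with k_1 = 1. *)
Lemma Rintegral_kfun_rev (b x u : R) : 0 < b -> 0 <= x < u ->
  integral_on x u (fun s => kfun b (u - s)) = kfun (b + 1) (u - x).
Proof.
move=> b0 /andP[x0 xu]; have ux0 : 0 < u - x by rewrite subr_gt0.
rewrite addrC -(Rintegral_kfun_conv ltr01 b0 ux0) /Rintegral; congr fine.
rewrite integral_mkcond (@ge0_integral_affine _ _ 1 x)//.
- rewrite mul1e [RHS]integral_mkcond; apply: eq_integral => s _.
  rewrite !patchE mul1r (_ : (s + x \in _) = (s \in `]0, u - x[%classic)).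
    by rewrite kfun1 mul1r (_ : u - (s + x) = u - x - s)//; ring.
  by apply/idP/idP; rewrite !inE /= !in_itv /= => /andP[? ?]; apply/andP; lra.
- apply: (measurable_restrictT _ (measurable_itv _)).1.
  apply/measurable_EFinP; apply: measurable_funTS; exact: measurable_kfun_rev.
- by move=> s; rewrite patchE; case: ifP => // _; rewrite lee_fin kfun_ge0.
Qed.

End riemann_liouville_kernel.

Section mesh_kernels.
Context {R : realType}.
Local Notation mu := (@lebesgue_measure R).
Local Notation integrable_on x y f := (rintegrable mu `]x, y[ f).
Local Notation integral_on x y f := (\int[mu]_(s in `]x, y[) f s).
Variables (alpha : R) (t : nat -> R).
Hypotheses (alpha01 : 0 < alpha < 1) (t0 : t 0%N = 0) (t_lt : forall i, t i < t i.+1).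

Let beta_gt0 : 0 < 1 - alpha. Proof. by rewrite subr_gt0; case/andP: alpha01. Qed.
Let beta_le1 : 0 < 1 - alpha <= 1.
Proof. by case/andP: alpha01 => a0 a1; apply/andP; split; lra. Qed.

Lemma mesh_le i j : (i <= j)%N -> t i <= t j.
Proof.
move=> ij; rewrite -(subnK ij); elim: (j - i)%N => //= k ih.
by rewrite addSn (le_trans ih)// ltW.
Qed.

Lemma mesh_lt i j : (i < j)%N -> t i < t j.
Proof. by move=> ij; apply: lt_le_trans (t_lt i) (mesh_le ij). Qed.

Lemma mesh_ge0 i : 0 <= t i. Proof. by rewrite -t0 mesh_le. Qed.

Lemma mesh_gt0 i : (0 < i)%N -> 0 < t i. Proof. by move=> i0; rewrite -t0 mesh_lt. Qed.

Lemma tstep_gt0 i : (0 < i)%N -> 0 < tstep t i.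
Proof. by case: i => // i _; rewrite /tstep subr_gt0 t_lt. Qed.

Lemma Rintegral_mesh f n : integrable_on 0 (t n) f ->
  integral_on 0 (t n) f = \sum_(1 <= i < n.+1) integral_on (t i.-1) (t i) f.
Proof.
elim: n => [|n ih] hf; first by rewrite t0 set_itvoo0 Rintegral_set0 big_geq.
rewrite big_nat_recr//= -ih; last by apply: rintegrable_oitvS hf => //; exact/ltW/t_lt.
by apply: Rintegral_oitv_split => //; exact: mesh_ge0.
Qed.

Lemma rintegrable_Kker n j : (0 < j <= n)%N ->
  integrable_on (t j.-1) (t j) (fun s => kfun (1 - alpha) (t n - s)).
Proof.
move=> /andP[j0 jn]; apply: (@rintegrable_oitvS _ _ _ 0 (t n)); first exact: mesh_ge0.
  exact: mesh_le.
by apply: rintegrable_kfun_rev => //; apply: mesh_gt0; exact: leq_trans jn.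
Qed.

(** The open interval leaves out the end point s = t_n, where the power function
    takes the value 0 instead of infinity and breaks monotonicity. *)
Lemma KkerE n j : (0 < j <= n)%N -> Kker alpha t n j =
  (tstep t j)^-1 * integral_on (t j.-1) (t j) (fun s => kfun (1 - alpha) (t n - s)).
Proof.
move=> jn; rewrite /Kker /Rintegral; congr (_ * fine _).
by rewrite (@integral_itv_bndoo _ _ _ _ true false)//; exact: measurable_int (rintegrable_Kker jn).
Qed.

Lemma Kker_diag n : (0 < n)%N ->
  Kker alpha t n n = ((tstep t n) `^ alpha * Gamma (2 - alpha))^-1.
Proof.
move=> n0; have s0 := tstep_gt0 n0.
rewrite KkerE ?n0 ?leqnn// Rintegral_kfun_rev// ?mesh_ge0 ?mesh_lt ?prednK//.
rewrite -/(tstep t n) /kfun (_ : 1 - alpha + 1 = 2 - alpha); last by ring.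
rewrite (_ : 2 - alpha - 1 = 1 - alpha); last by ring.
have s1 : tstep t n != 0 by rewrite gt_eqF.
rewrite powRB ?s1 ?implybT// powRr1 ?(ltW s0)// !mulrA mulVf// mul1r.
by rewrite invfM.
Qed.

Lemma tratio_ge0 n : (1 < n)%N -> 0 <= tratio t n.
Proof.
move=> n1; have n0 : (0 < n.-1)%N by rewrite -ltnS prednK// ltnW.
have := tstep_gt0 n0; have := tstep_gt0 (ltnW n1).
by rewrite /tratio => s1 s2; rewrite divr_ge0// ltW.
Qed.

(** This is how the restriction on the step size is used. *)
Lemma Kker_diag_ge n (L : R) : (0 < n)%N -> 0 < L ->
  tstep t n < (1 / (2 * L * Gamma (2 - alpha))) `^ (1 / alpha) ->
  2 * L <= Kker alpha t n n.
Proof.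
move=> n0 L0; have s0 := tstep_gt0 n0; have /andP[a0 a1] := alpha01.
rewrite Kker_diag//; have : 0 < Gamma (2 - alpha) by apply: Gamma_gt0; lra.
move: (Gamma _) (tstep t n) s0 => G s s0 G0 h.
have L20 : 0 < 2 * L by rewrite mulr_gt0.
have := gt0_ltr_powR a0 _ _ h; rewrite !nnegrE powR_ge0 (ltW s0) => /(_ isT isT).
rewrite -powRrM !div1r mulVf ?gt_eqF// powRr1; last by rewrite invr_ge0 mulr_ge0// ltW.
move=> /ltW; have p0 : 0 < s `^ alpha by rewrite powR_gt0.
move: (s `^ alpha) p0 => p p0; rewrite -(ler_pM2r (mulr_gt0 L20 G0)) mulVf ?gt_eqF ?mulr_gt0//.
by move=> hp; rewrite -div1r ler_pdivlMr ?mulr_gt0// mulrCA.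
Qed.

(** Both averages are compared with the value of the increasing function
    s |-> k(t_n - s) at the common end point t_j of the two mesh intervals. *)
Lemma Kker_le n j : (0 < j < n)%N -> Kker alpha t n j <= Kker alpha t n j.+1.
Proof.
move=> /andP[j0 jn]; have tjn : t j < t n by exact: mesh_lt.
apply: (@le_trans _ _ (kfun (1 - alpha) (t n - t j))).
  have jn' : (0 < j <= n)%N by rewrite j0 ltnW.
  rewrite KkerE// mulrC ler_pdivrMr ?tstep_gt0//.
  rewrite -Rintegral_oitv_cst; last by apply: mesh_le; exact: leq_pred.
  apply: le_Rintegral_oitv; [exact: rintegrable_Kker|exact: rintegrable_oitv_cst|].
  move=> s /andP[_ sj].
  by apply: kfun_ge => //; rewrite subr_gt0 tjn/= lerD2l lerN2 ltW.
have jn' : (0 < j.+1 <= n)%N by [].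
rewrite KkerE// mulrC ler_pdivlMr ?tstep_gt0//.
rewrite -Rintegral_oitv_cst; last exact/ltW/t_lt.
apply: le_Rintegral_oitv; [exact: rintegrable_oitv_cst|exact: rintegrable_Kker|].
move=> s /andP[js sj].
have sn : s < t n by apply: lt_le_trans sj (mesh_le _).
by apply: kfun_ge => //; rewrite subr_gt0 sn/= lerD2l lerN2 ltW.
Qed.

Lemma Kker_diag_gt0 n : (0 < n)%N -> 0 < Kker alpha t n n.
Proof.
move=> n0; rewrite Kker_diag// invr_gt0 mulr_gt0 ?powR_gt0 ?tstep_gt0//.
by rewrite Gamma_gt0//; case/andP: alpha01; lra.
Qed.

Lemma Kker_ge0 n j : (0 < j <= n)%N -> 0 <= Kker alpha t n j.
Proof.
move=> jn; rewrite KkerE// mulr_ge0//.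
  by rewrite invr_ge0 ltW// tstep_gt0//; case/andP: jn.
by apply: Rintegral_ge0 => s _; exact: kfun_ge0.
Qed.

(** Downward induction on i: the recursion has nonnegative coefficients since
    K^{j,i} increases in i. *)
Lemma Pker_ge0 n i : (0 < i <= n)%N -> 0 <= Pker alpha t n i.
Proof.
elim/ltn_ind: {i}(n - i)%N {-2}i (erefl (n - i)%N) => k ih i ki /andP[i0].
rewrite leq_eqVlt => /predU1P[<-|iltn].
  by rewrite Pker_diag invr_ge0 ltW// Kker_diag_gt0.
rewrite PkerE// mulr_ge0//; first by rewrite invr_ge0 ltW// Kker_diag_gt0.
rewrite big_nat; apply: sumr_ge0 => j /andP[ij jn]; rewrite mulr_ge0//.
  by apply: (ih (n - j)%N) => //; lia.
by rewrite subr_ge0; apply: Kker_le; lia.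
Qed.

(** The recursion that defines P^{n,i} says exactly that the sum for i equals the
    sum for i + 1; for i = n the sum is 1. *)
Lemma Pker_Kker n i : (0 < i <= n)%N ->
  \sum_(i <= j < n.+1) Pker alpha t n j * Kker alpha t j i = 1.
Proof.
move=> /andP[i0]; rewrite leq_eqVlt => /predU1P[<-|].
  by rewrite big_nat1 Pker_diag mulVf// gt_eqF// Kker_diag_gt0.
move=> iltn; move: i0.
have [k nk] : {k | n = (i + k)%N} by exists (n - i)%N; lia.
elim: k i nk iltn => [|k ih] i nk iltn i0; first by lia.
rewrite big_ltn; last by lia.
rewrite {1}PkerE// mulrAC mulVf ?mul1r; last by rewrite gt_eqF// Kker_diag_gt0.
rewrite -big_split /=; under eq_bigr do rewrite -mulrDr subrK.
case: (ltnP i.+1 n) => h; first by apply: ih => //; lia.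
have <- : i.+1 = n by lia.
by rewrite big_nat1 Pker_diag mulVf// gt_eqF// Kker_diag_gt0.
Qed.

End mesh_kernels.

(** * Discrete fractional integrals of power functions *)

Section triangle.
Variables (R : realType) (m : nat).
Lemma sum_triangle (F : nat -> nat -> R) n :
  \sum_(m <= j < n) \sum_(m <= i < j.+1) F j i =
  \sum_(m <= i < n) \sum_(i <= j < n) F j i.
Proof.
transitivity (\sum_(m <= j < n) \sum_(m <= i < n | (i < j.+1)%N) F j i).
  rewrite big_nat [RHS]big_nat; apply: eq_bigr => j /andP[_ jn].
  by rewrite (big_nat_widen _ _ n).
rewrite (exchange_big_dep_nat xpredT)//= big_nat [RHS]big_nat.
by apply: eq_bigr => i /andP[mi _]; rewrite [RHS](big_nat_widenl _ m).
Qed.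
End triangle.

Section complementary_kernel.
Context {R : realType}.
Local Notation mu := (@lebesgue_measure R).
Local Notation integrable_on x y f := (rintegrable mu `]x, y[ f).
Local Notation integral_on x y f := (\int[mu]_(s in `]x, y[) f s).
Variables (alpha : R) (t : nat -> R).
Hypotheses (alpha01 : 0 < alpha < 1) (t0 : t 0%N = 0) (t_lt : forall i, t i < t i.+1).

Let beta_gt0 : 0 < 1 - alpha. Proof. by rewrite subr_gt0; case/andP: alpha01. Qed.
Let beta_le1 : 0 < 1 - alpha <= 1.
Proof. by case/andP: alpha01 => a0 a1; apply/andP; split; lra. Qed.

(** After an exchange of the sums, w_i carries the weight 1.  With the increments of
    y for w, the complementary kernels turn the L1 operator back into y_n - y_0. *)
Lemma Pker_sum_Kker n (w : nat -> R) :
  \sum_(1 <= j < n.+1) Pker alpha t n j * (\sum_(1 <= i < j.+1) Kker alpha t j i * w i) =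
  \sum_(1 <= i < n.+1) w i.
Proof.
under eq_bigr do rewrite mulr_sumr.
rewrite sum_triangle big_nat [RHS]big_nat; apply: eq_bigr => i ilen.
under eq_bigr do rewrite mulrA.
by rewrite -mulr_suml Pker_Kker// mul1r.
Qed.

(** Without its last term, the sum of P^{n,j} K^{j,i} over j is at most 1. *)
Lemma Pker_sum_Kker_lt n (w : nat -> R) : (forall i, (0 < i)%N -> 0 <= w i) ->
  \sum_(1 <= j < n) Pker alpha t n j * (\sum_(1 <= i < j.+1) Kker alpha t j i * w i) <=
  \sum_(1 <= i < n) w i.
Proof.
move=> w0; under eq_bigr do rewrite mulr_sumr.
rewrite sum_triangle big_nat [leRHS]big_nat; apply: ler_sum => i /andP[i0 iltn].
under eq_bigr do rewrite mulrA.
rewrite -mulr_suml ler_piMl ?w0//.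
have ilen : (0 < i <= n)%N by rewrite i0 ltnW.
rewrite -(Pker_Kker alpha01 t0 t_lt ilen) big_nat_recr/=; last exact: ltnW.
rewrite lerDl mulr_ge0//; last by apply: Kker_ge0 => //; rewrite i0 ltnW.
by apply: Pker_ge0; rewrite // leqnn andbT; lia.
Qed.

Hypothesis tstep_le : forall i, (0 < i)%N -> tstep t i <= tstep t i.+1.

(** Discrete counterpart of the fractional integral
    I^alpha k_{c+1-alpha} = k_{c+1}.  The sum stops at j = n - 1: this leaves one mesh
    interval free, which the increasing case c > 1 uses up. *)
Lemma Pker_kfun (c : R) n : 0 < c -> (0 < n)%N ->
  \sum_(1 <= j < n) Pker alpha t n j * kfun (c + 1 - alpha) (t j) <= kfun (c + 1) (t n).
Proof.
move=> c0 n0.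
pose v i := integral_on (t i.-1) (t i) (kfun c).
have vint i j : (i < j)%N -> integrable_on (t i) (t j) (kfun c).
  move=> ij; apply: (@rintegrable_oitvS _ _ _ 0 (t j)) => //; first exact: mesh_ge0.
  by apply: rintegrable_kfun => //; apply: mesh_gt0 => //; lia.
have v0 i : 0 <= v i by apply: Rintegral_ge0 => s _; exact: kfun_ge0.
have sumv : \sum_(1 <= i < n.+1) v i = kfun (c + 1) (t n).
  have tn0 : 0 < t n by exact: mesh_gt0.
  by rewrite -Rintegral_mesh ?Rintegral_kfun//; exact: rintegrable_kfun.
(* The weights w_i stand for the mass of k_c on the i-th interval after k_c has been
   averaged against K^{j,i}; their sum must not exceed the mass k_{c+1}(t_n). *)
suff [w [w0 wv wK]] : exists w : nat -> R, [/\ forall i, (0 < i)%N -> 0 <= w i,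
    \sum_(1 <= i < n) w i <= \sum_(1 <= i < n.+1) v i &
    forall j i, (0 < i <= j)%N ->
      integral_on (t i.-1) (t i) (fun s => kfun c s * kfun (1 - alpha) (t j - s)) <=
      Kker alpha t j i * w i].
  rewrite -sumv; apply: le_trans wv; apply: le_trans (Pker_sum_Kker_lt n w0).
  rewrite big_nat [leRHS]big_nat; apply: ler_sum => j /andP[j0 jn]; apply: ler_wpM2l.
    by apply: Pker_ge0 => //; rewrite j0 ltnW.
  have tj0 : 0 < t j by exact: mesh_gt0.
  rewrite -addrA -Rintegral_kfun_conv// (Rintegral_mesh t0 t_lt); last first.
    exact: rintegrable_kfun_conv.
  by rewrite big_nat [leRHS]big_nat; apply: ler_sum => i; rewrite ltnS; exact: wK.
have convint j i : (0 < i <= j)%N ->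
    integrable_on (t i.-1) (t i) (fun s => kfun c s * kfun (1 - alpha) (t j - s)).
  move=> /andP[i0 ij]; apply: (@rintegrable_oitvS _ _ _ 0 (t j)); first exact: mesh_ge0.
    exact: mesh_le.
  by apply: rintegrable_kfun_conv => //; apply: mesh_gt0 => //; lia.
have tlt i : (0 < i)%N -> t i.-1 < t i by move=> i0; rewrite mesh_lt// prednK.
have [c1|c1] := leP c 1.
- exists v; split=> [i _||j i ij]; first exact: v0.
    by rewrite big_nat_recr//= lerDl.
  have i0 : (0 < i)%N by case/andP: ij.
  rewrite KkerE// -mulrA ler_pdivlMl ?tstep_gt0// [X in _ <= X]mulrC.
  under eq_Rintegral do rewrite mulrC.
  rewrite [X in _ <= X]mulrC; apply: chebyshev_integral.
  + exact/ltW/tlt.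
  + exact: rintegrable_Kker.
  + by apply: vint; rewrite prednK.
  + by have := convint _ _ ij; congr rintegrable; apply/funext => s; exact: mulrC.
  + move=> r s /andP[xr ry] /andP[xs sy] rs; have tij : t i <= t j.
      by apply: mesh_le => //; case/andP: ij.
    split; apply: kfun_ge => //.
    * by apply/andP; split; lra.
    * by rewrite c0.
    * by rewrite rs andbT (le_lt_trans _ xr)// mesh_ge0.
- have le0t i : 0 <= t i by exact: mesh_ge0.
  exists (fun i => tstep t i * kfun c (t i)); split=> [i i0||j i ij].
  + by rewrite mulr_ge0 ?kfun_ge0// ltW// tstep_gt0.
  (* The mass of interval i is charged to interval i + 1, which is longer and on
     which k_c exceeds k_c(t_i). *)
  + rewrite [leRHS]big_ltn// [X in _ + X]big_add1 /= -[leLHS]add0r lerD//.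
    rewrite big_nat [leRHS]big_nat.
    apply: ler_sum => i /andP[i0 iltn].
    apply: (@le_trans _ _ (tstep t i.+1 * kfun c (t i))).
      by rewrite ler_wpM2r ?kfun_ge0// tstep_le.
    rewrite mulrC -Rintegral_oitv_cst; last exact/ltW/t_lt.
    apply: le_Rintegral_oitv; [exact: rintegrable_oitv_cst|exact: vint|].
    move=> s /andP[is_ _].
    by apply: kfun_le; [exact: ltW|rewrite le0t ltW].
  + have i0 : (0 < i)%N by case/andP: ij.
    rewrite KkerE// mulrACA mulVf ?mul1r; last by rewrite gt_eqF// tstep_gt0.
    rewrite [leRHS]mulrC -Rintegral_oitvZ; last exact: rintegrable_Kker.
    apply: le_Rintegral_oitv; [exact: convint|exact/rintegrableZ/rintegrable_Kker|].
    move=> s /andP[is_ si].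
    rewrite ler_wpM2r ?kfun_ge0//; apply: kfun_le; first exact: ltW.
    by rewrite (ltW si) andbT ltW// (le_lt_trans _ is_).
Qed.

End complementary_kernel.

(** * The Mittag-Leffler function and the discrete fractional Gronwall inequality *)

Section mittag_leffler.
Context {R : realType}.
Variable alpha : R.
Hypothesis alpha0 : 0 < alpha.

Definition ml_term (z : R) (j : nat) : R := z ^+ j / Gamma (j%:R * alpha + 1).

Let exponent_gt0 (j : nat) : 0 < j%:R * alpha + 1.
Proof. by rewrite ltr_wpDl// mulr_ge0// ltW. Qed.

Lemma ml_term_ge0 z j : 0 <= z -> 0 <= ml_term z j.
Proof. by move=> z0; rewrite divr_ge0 ?exprn_ge0// ltW// Gamma_gt0. Qed.

Lemma ml_term0 z : ml_term z 0 = 1.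
Proof. by rewrite /ml_term expr0 mul0r add0r Gamma1 divr1. Qed.

(** Comparison with a geometric series of ratio 1/2, the growth of Gamma being
    tuned to z. *)
Lemma is_cvg_ml z : 0 <= z -> cvgn (series (ml_term z)).
Proof.
(* A^alpha = 2 (z + 1) makes Gamma(j alpha + 1) grow like (2 (z + 1))^j. *)
move=> z0; pose A : R := (2 * (z + 1)) `^ alpha^-1.
have z1 : 0 < 2 * (z + 1) by lra.
have A0 : 0 < A by rewrite powR_gt0.
have AE : A `^ alpha = 2 * (z + 1).
  by rewrite /A -powRrM mulVf ?gt_eqF// powRr1// ltW.
apply: (@series_le_cvg _ _ (geometric (expR (A + 1)) 2^-1)).
- by move=> j; exact: ml_term_ge0.
- by move=> j; rewrite /geometric /= mulr_ge0 ?expR_ge0// exprn_ge0// invr_ge0.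
- move=> j; rewrite /ml_term /geometric /= ler_pdivrMr ?Gamma_gt0//.
  have jalpha : 0 <= j%:R * alpha by rewrite mulr_ge0// ltW.
  apply: le_trans (ler_wpM2l _ (Gamma1p_ge jalpha A0)); last first.
    by rewrite mulr_ge0 ?expR_ge0// exprn_ge0// invr_ge0.
  rewrite (mulrC j%:R) powRrM AE powR_mulrn ?(ltW z1)//.
  rewrite (mulrC (_ ^+ j)) mulrACA -expRD subrr expR0 mul1r -exprMn.
  by rewrite lerXn2r ?nnegrE//; lra.
- by apply: is_cvg_geometric_series; rewrite ger0_norm ?invr_ge0// invf_lt1// ltr1n.
Qed.

Lemma ml_series_le z n : 0 <= z -> series (ml_term z) n <= mittag_leffler alpha z.
Proof.
move=> z0; apply: nondecreasing_cvgn_le; last exact: is_cvg_ml.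
by apply/nondecreasing_seqP => k; rewrite -subr_ge0 seriesSB ml_term_ge0.
Qed.

Lemma mittag_leffler_ge1 z : 0 <= z -> 1 <= mittag_leffler alpha z.
Proof.
move=> z0; apply: le_trans (ml_series_le 1 z0).
by rewrite /series /= big_nat1 ml_term0.
Qed.

Lemma le_mittag_leffler z z' : 0 <= z <= z' ->
  mittag_leffler alpha z <= mittag_leffler alpha z'.
Proof.
move=> /andP[z0 zz]; have z'0 := le_trans z0 zz.
apply: ler_lim; [exact: is_cvg_ml|exact: is_cvg_ml|].
apply: nearW => n; rewrite /series /=; apply: ler_sum => j _.
by rewrite ler_wpM2r ?invr_ge0 ?(ltW (Gamma_gt0 _))// lerXn2r.
Qed.

Lemma ml_term_kfun (k u : R) j : 0 <= u ->
  ml_term (k * u `^ alpha) j = k ^+ j * kfun (j%:R * alpha + 1) u.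
Proof.
move=> u0; rewrite /ml_term /kfun addrK exprMn -[_ `^ alpha ^+ j]powR_mulrn ?powR_ge0//.
by rewrite -powRrM (mulrC alpha) mulrA.
Qed.

End mittag_leffler.

Section gronwall.
Context {R : realType}.
Variables (alpha : R) (t : nat -> R).
Hypotheses (alpha01 : 0 < alpha < 1) (t0 : t 0%N = 0) (t_lt : forall i, t i < t i.+1).
Hypothesis tstep_le : forall i, (0 < i)%N -> tstep t i <= tstep t i.+1.

Let alpha0 : 0 < alpha. Proof. by case/andP: alpha01. Qed.
Let tge0 i : 0 <= t i. Proof. exact: mesh_ge0. Qed.

(** Each term of the series is mapped below the next one, so the M-th partial sum
    on the left is below the (M+1)-st on the right without its first term 1. *)
Lemma Pker_mittag_leffler (k : R) n : 0 <= k -> (0 < n)%N ->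
  \sum_(1 <= j < n) Pker alpha t n j * (k * mittag_leffler alpha (k * t j `^ alpha)) <=
  mittag_leffler alpha (k * t n `^ alpha) - 1.
Proof.
move=> k0 n0; have z0 i : 0 <= k * t i `^ alpha by rewrite mulr_ge0 ?powR_ge0.
pose S M := \sum_(1 <= j < n) Pker alpha t n j *
  (k * series (ml_term alpha (k * t j `^ alpha)) M).
have Scvg : S M @[M --> \oo] --> \sum_(1 <= j < n) Pker alpha t n j *
    (k * mittag_leffler alpha (k * t j `^ alpha)).
  apply: cvg_big => [|j _]; first exact: add_continuous.
  by apply: cvgMl_tmp; apply: cvgMl_tmp; exact: is_cvg_ml.
apply: (cvgr_to_le Scvg); apply: nearW => M; rewrite lerBrDl.
apply: le_trans (ml_series_le alpha0 M.+1 (z0 n)).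
rewrite /series /= big_nat_recl// ml_term0 lerD2l.
rewrite /S /series /=.
under eq_bigr do rewrite mulr_sumr mulr_sumr.
rewrite exchange_big /=; apply: ler_sum => m _.
rewrite ml_term_kfun//.
have c0 : 0 < m.+1%:R * alpha by rewrite mulr_gt0.
apply: le_trans (ler_wpM2l (exprn_ge0 _ k0) (Pker_kfun alpha01 t0 t_lt tstep_le c0 n0)).
rewrite mulr_sumr; apply: ler_sum => j _; rewrite ml_term_kfun//.
rewrite (_ : m.+1%:R * alpha + 1 - alpha = m%:R * alpha + 1); last by rewrite -natr1; ring.
by rewrite exprS le_eqVlt; apply/orP; left; apply/eqP; ring.
Qed.

(** The sequence e is any supersolution of the linear problem with rate
    2 Lambda.  The first bound on y is stated through all upper bounds M of
    y_0, ..., y_m; this replaces a running maximum. *)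
Lemma discrete_gronwall (Lambda G : R) (y F e : nat -> R) n :
  0 < Lambda -> (forall i, 0 <= y i) ->
  (forall m, 1 <= e m) -> (forall i m, (i <= m)%N -> e i <= e m) ->
  (forall m, (0 < m)%N ->
    \sum_(1 <= j < m) Pker alpha t m j * (2 * Lambda * e j) <= e m - 1) ->
  (forall m, (0 < m <= n)%N -> 2 * Lambda <= Kker alpha t m m) ->
  (forall m M, (0 < m <= n)%N -> (forall i, (i <= m)%N -> y i <= M) ->
    \sum_(1 <= j < m.+1) Kker alpha t m j * (y j - y j.-1) <= Lambda / 2 * M + F m) ->
  y 0%N <= G ->
  (forall m, (0 < m <= n)%N -> y 0%N + \sum_(1 <= i < m.+1) Pker alpha t m i * F i <= G) ->
  forall m, (m <= n)%N -> y m <= 2 * G * e m.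
Proof.
move=> L0 y0 e1 ele eP hK hD hG0 hG.
have G0 : 0 <= G by apply: le_trans hG0.
have G20 : 0 <= 2 * G by rewrite mulr_ge0.
elim/ltn_ind => m ih mn.
have [m0|m0] := posnP m; first by rewrite m0; have := e1 0%N; nra.
(* If the bound fails at m for the first time then y m is the running maximum, since
   e increases. *)
rewrite leNgt; apply/negP => ym.
have ylt i j : (i <= j)%N -> (j < m)%N -> y i <= 2 * G * e j.
  move=> ij jm; apply: le_trans (ih i _ _) _; [lia|lia|].
  by apply: ler_wpM2l => //; exact: ele.
have ymax i : (i <= m)%N -> y i <= y m.
  rewrite leq_eqVlt => /predU1P[->//|im]; apply/ltW; apply: le_lt_trans ym.
  by apply: le_trans (ylt i i _ im) _ => //; apply: ler_wpM2l => //; apply: ele; exact: ltnW.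
have mn' : (0 < m <= n)%N by rewrite m0.
pose D j := \sum_(1 <= i < j.+1) Kker alpha t j i * (y i - y i.-1).
have PD : \sum_(1 <= j < m.+1) Pker alpha t m j * D j = y m - y 0%N.
  rewrite (Pker_sum_Kker alpha01 t0 t_lt) big_add1 /=.
  by rewrite telescope_sumr.
have Pge0 j : (0 < j <= m)%N -> 0 <= Pker alpha t m j by exact: Pker_ge0.
have hPD : y m - y 0%N <= \sum_(1 <= j < m) Pker alpha t m j * (Lambda / 2 * (2 * G * e j))
    + Pker alpha t m m * (Lambda / 2 * y m) + \sum_(1 <= j < m.+1) Pker alpha t m j * F j.
  rewrite -PD big_nat_recr//= [X in _ <= _ + X]big_nat_recr//= addrACA -big_split /= lerD//.
    rewrite big_nat [leRHS]big_nat; apply: ler_sum => j /andP[j0 jm].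
    rewrite -mulrDr ler_wpM2l//; first by apply: Pge0; rewrite j0 ltnW.
    apply: hD; first by rewrite j0 (leq_trans (ltnW jm)).
    by move=> i ij; exact: ylt.
  rewrite -mulrDr ler_wpM2l//; first by apply: Pge0; rewrite m0 leqnn.
  exact: hD.
have hML := eP m m0.
(* In all, 3/4 y_m <= G + G / 2 * (e_m - 1) <= G * e_m. *)
have h1 : \sum_(1 <= j < m) Pker alpha t m j * (Lambda / 2 * (2 * G * e j)) <=
    G / 2 * (e m - 1).
  apply: le_trans (ler_wpM2l _ hML); last by lra.
  rewrite mulr_sumr; apply: ler_sum => j _.
  by rewrite le_eqVlt; apply/orP; left; apply/eqP; field.
have h2 : Pker alpha t m m * (Lambda / 2 * y m) <= y m / 4.
  rewrite Pker_diag mulrC -ler_pdivlMr ?invr_gt0 ?Kker_diag_gt0// invrK.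
  by have := hK _ mn'; have := y0 m; nra.
have h3 := hG _ mn'.
have := e1 m; nra.
Qed.
End gronwall.

Section graded_mesh.
Context {R : realType}.
Variables (T gamma : R) (N : nat).
Hypotheses (T0 : 0 < T) (gamma1 : 1 <= gamma) (N1 : (1 < N)%N).
Local Notation tm := (mesh T gamma N).

Let N0 : 0 < N%:R :> R. Proof. by rewrite ltr0n ltnW. Qed.
Let gamma0 : 0 < gamma. Proof. exact: lt_le_trans gamma1. Qed.

Lemma mesh0 : tm 0%N = 0.
Proof. by rewrite /mesh mul0r powR0 ?mul0r// gt_eqF. Qed.

Lemma meshN : tm N = T.
Proof. by rewrite /mesh divff ?gt_eqF// powR1 mul1r. Qed.

Lemma mesh_increasing i : tm i < tm i.+1.
Proof.
rewrite /mesh ltr_pM2r// gt0_ltr_powR// ?nnegrE ?divr_ge0//.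
by rewrite ltr_pM2r ?invr_gt0// ltr_nat.
Qed.

(** The map x |-> x^gamma is convex, and i + 1 is the midpoint of i and i + 2. *)
Lemma mesh_tstep_le i : (0 < i)%N -> tstep tm i <= tstep tm i.+1.
Proof.
case: i => // i _; rewrite /tstep /= /mesh -!mulrBl ler_pM2r//.
pose x (k : nat) : R := k%:R / N%:R; rewrite -/(x i) -/(x i.+1) -/(x i.+2).
have h0 : 0 <= 2^-1 :> R by lra.
have h1 : 2^-1 <= 1 :> R by lra.
have xge0 k : x k \in (`[0, +oo[%classic : set R).
  by rewrite inE /= in_itv /= andbT divr_ge0.
have := convex_powR gamma1 (Itv01 h0 h1) (xge0 i) (xge0 i.+2).
rewrite [X in X `^ _ <= _ -> _]convRE convRE /= /unstable.onem.
have -> : 2^-1 * x i + (1 - 2^-1) * x i.+2 = x i.+1.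
  by rewrite /x -!natr1; field; rewrite gt_eqF.
lra.
Qed.
End graded_mesh.

Section max_from.
Context {R : realType}.
Lemma le_max_from m n i (F : nat -> R) : (m <= i <= n)%N -> F i <= max_from m n F.
Proof.
move=> /andP[mi ilen]; rewrite /max_from.
by apply: le_bigmax_seq; rewrite ?mem_index_iota ?mi ?ltnS.
Qed.
End max_from.

(** * The space of square-integrable functions on the domain *)

Section domain.
Context {R : realType} {d : nat}.
Implicit Types (Omega : set 'rV[R]_d).

Lemma measurable_dotv (nu : 'rV[R]_d) : measurable_fun [set: 'rV[R]_d] (dotv nu).
Proof.
apply: measurable_sum => i; apply: measurable_funM => //.
exact: measurable_row_coord.
Qed.

Lemma measurable_polytope Omega : convex_polytope_domain Omega -> measurable Omega.
Proof.
case=> _ _ [m [nu [b ->]]].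
rewrite (_ : [set _ | _] = \bigcap_(k in [set: 'I_m]) (dotv (nu k) @^-1` `]-oo, b k[)); last first.
  apply/seteqP; split => [x h k _|x h k]; first by rewrite /= in_itv /=; exact: h.
  by have := h k I; rewrite /= in_itv.
apply: fin_bigcap_measurable => // k _; rewrite -[X in measurable X]setTI.
exact: measurable_dotv.
Qed.

Lemma leb_bounded Omega : bounded_set Omega -> measurable Omega -> (leb d Omega < +oo)%E.
Proof.
move=> [M [_ hM]] mO; pose r : R := `|M| + 1.
have r0 : 0 <= r by rewrite /r addr_ge0.
pose B := [set x : 'rV[R]_d | forall i, x ord0 i \in `](- (r + 1)), r]].
apply: (@le_lt_trans _ _ (leb d B)).
  apply: le_measure; rewrite ?inE//; first exact: measurable_box.
  have Mr : M < r by rewrite /r (le_lt_trans (ler_norm M)) ?ltrDl.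
  move=> x Ox i; have /= xr := hM r Mr x Ox.
  have : `|x ord0 i| <= r.
    apply: le_trans xr; rewrite [leRHS]/Num.norm /= mx_normrE.
    exact: (le_bigmax _ (fun ij => `|x ij.1 ij.2|) (ord0, i)).
  by rewrite in_itv /= ler_norml => /andP[h1 h2]; apply/andP; split; lra.
rewrite leb_box ?ltry// => i; lra.
Qed.
End domain.

Section L2.
Context {R : realType} {d : nat} (Omega : set 'rV[R]_d).
Hypothesis mO : measurable Omega.
Local Notation rint := (rintegrable (leb d) Omega).
Local Notation ip := (L2ip Omega).
Local Notation nrm := (L2norm Omega).
Local Notation L2 := (L2fun Omega).
Implicit Types (f g h : 'rV[R]_d -> R).

Lemma L2fun_mul f g : L2 f -> L2 g -> rint (fun x => f x * g x).
Proof.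
move=> [mf f2] [mg g2]; apply: (@rintegrable_le _ _ _ _ _ mO _ (fun x => f x ^+ 2 + g x ^+ 2)).
- exact: measurable_funM.
- move=> x _; rewrite normrM -(real_normK (num_real (f x))) -(real_normK (num_real (g x))).
  have := sqr_ge0 (`|f x| - `|g x|); have := normr_ge0 (f x); have := normr_ge0 (g x); nra.
- exact: rintegrableD.
Qed.

Lemma L2funD f g : L2 f -> L2 g -> L2 (fun x => f x + g x).
Proof.
move=> hf hg; split; first by apply: measurable_funD; [case: hf|case: hg].
have fg := L2fun_mul hf hg; case: hf hg => mf f2 [mg g2].
have := rintegrableD mO (rintegrableD mO f2 g2) (rintegrableZ mO 2 fg).
by congr rintegrable; apply/funext => x; ring.
Qed.

Lemma L2funZ c f : L2 f -> L2 (fun x => c * f x).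
Proof.
move=> [mf f2]; split; first exact: measurable_funM.
have := rintegrableZ mO (c ^+ 2) f2.
by congr rintegrable; apply/funext => x; ring.
Qed.

Lemma L2funB f g : L2 f -> L2 g -> L2 (fun x => f x - g x).
Proof.
move=> hf hg; have := L2funD hf (L2funZ (-1) hg).
by congr (L2fun _ _); apply/funext => x; ring.
Qed.

Lemma L2fun0 : L2 (fun=> 0).
Proof.
split; first exact: measurable_cst.
have := integrable0 (leb d) Omega.
by congr (_.-integrable _ _); apply/funext => x /=; rewrite expr0n.
Qed.

Lemma L2fun_sum (I : eqType) (r : seq I) (F : I -> 'rV[R]_d -> R) :
  (forall i, i \in r -> L2 (F i)) -> L2 (fun x => \sum_(i <- r) F i x).
Proof.
elim: r => [|i r ih] hF.
  by have := L2fun0; congr (L2fun _ _); apply/funext => x; rewrite big_nil.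
have hi : L2 (F i) by apply: hF; rewrite mem_head.
have hr : L2 (fun x => \sum_(i <- r) F i x).
  by apply: ih => j jr; apply: hF; rewrite inE jr orbT.
by have := L2funD hi hr; congr (L2fun _ _); apply/funext => x; rewrite big_cons.
Qed.

Lemma L2ipC f g : ip f g = ip g f.
Proof. by apply: eq_Rintegral => x _; rewrite mulrC. Qed.

Lemma L2ipDl f g h : L2 f -> L2 g -> L2 h ->
  ip (fun x => f x + g x) h = ip f h + ip g h.
Proof.
move=> hf hg hh; rewrite /L2ip -RintegralD; [|by []|exact: L2fun_mul|exact: L2fun_mul].
by apply: eq_Rintegral => x _; rewrite mulrDl.
Qed.

Lemma L2ipZl c f h : L2 f -> L2 h -> ip (fun x => c * f x) h = c * ip f h.
Proof.
move=> hf hh; rewrite /L2ip -RintegralZl; [|by []|exact: L2fun_mul].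
by apply: eq_Rintegral => x _; rewrite mulrA.
Qed.

Lemma L2ipBl f g h : L2 f -> L2 g -> L2 h ->
  ip (fun x => f x - g x) h = ip f h - ip g h.
Proof.
move=> hf hg hh; rewrite -mulN1r -L2ipZl// -L2ipDl//; last exact: L2funZ.
by congr L2ip; apply/funext => x; rewrite mulN1r.
Qed.

Lemma L2ip_suml (I : eqType) (r : seq I) (F : I -> 'rV[R]_d -> R) h :
  (forall i, i \in r -> L2 (F i)) -> L2 h ->
  ip (fun x => \sum_(i <- r) F i x) h = \sum_(i <- r) ip (F i) h.
Proof.
move=> + hh; elim: r => [|i r ih] hF.
  rewrite big_nil /L2ip; under eq_Rintegral do rewrite big_nil mul0r.
  by rewrite Rintegral_cst// mul0r.
have hi : L2 (F i) by apply: hF; rewrite mem_head.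
have hFr j : j \in r -> L2 (F j) by move=> jr; apply: hF; rewrite inE jr orbT.
rewrite big_cons -ih// -L2ipDl//; last exact: L2fun_sum.
by congr L2ip; apply/funext => x; rewrite big_cons.
Qed.

Lemma L2ip_ge0 f : 0 <= ip f f.
Proof. by apply: Rintegral_ge0 => x _; rewrite -expr2 sqr_ge0. Qed.

Lemma L2norm_ge0 f : 0 <= nrm f.
Proof. exact: sqrtr_ge0. Qed.

Lemma L2norm_sqr f : nrm f ^+ 2 = ip f f.
Proof. by rewrite sqr_sqrtr// L2ip_ge0. Qed.

Lemma L2ip_sqrB f g a b : L2 f -> L2 g ->
  0 <= a ^+ 2 * ip f f - 2 * (a * b) * ip f g + b ^+ 2 * ip g g.
Proof.
move=> hf hg; have haf := L2funZ a hf; have hbg := L2funZ b hg.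
have hB := L2funB haf hbg.
have := L2ip_ge0 (fun x => a * f x - b * g x).
rewrite L2ipBl// !(L2ipC _ (fun x => a * f x - b * g x)) !L2ipBl// !L2ipZl//.
rewrite !(L2ipC _ (fun x => _ * _)) !L2ipZl// (L2ipC g f); lra.
Qed.

(** The quadratic form of a f - b g is nonnegative for all a and b.  If g has norm
    0, a large multiple of g shows that the inner product vanishes. *)
Lemma cauchy_schwarz f g : L2 f -> L2 g -> `|ip f g| <= nrm f * nrm g.
Proof.
move=> hf hg; rewrite -(@ler_pXn2r _ 2)// ?nnegrE ?mulr_ge0 ?L2norm_ge0//.
rewrite exprMn !L2norm_sqr real_normK ?num_real//.
have f0 := L2ip_ge0 f; have g0 := L2ip_ge0 g.
have := L2ip_sqrB (ip g g) (ip f g) hf hg.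
have := L2ip_sqrB 1 ((ip f f + 1) / ip f g) hf hg.
move: f0 g0; set A := ip f f; set B := ip f g; set C := ip g g => f0 g0 h1 h2.
have [C0|C0] := eqVneq C 0; last first.
  have Cp : 0 < C by rewrite lt_neqAle eq_sym C0.
  by rewrite -(ler_pM2l Cp); nra.
have [->|B0] := eqVneq B 0; first by rewrite C0 mulr0 expr0n.
by move: h1; rewrite C0 mul1r -mulrA mulfVK//; lra.
Qed.

Lemma L2norm_triangle f g : L2 f -> L2 g -> nrm (fun x => f x + g x) <= nrm f + nrm g.
Proof.
move=> hf hg; have hfg := L2funD hf hg.
rewrite -(@ler_pXn2r _ 2)// ?nnegrE ?addr_ge0 ?L2norm_ge0//.
rewrite L2norm_sqr L2ipDl// !(L2ipC _ (fun x => f x + g x)) !L2ipDl// (L2ipC g f).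
have := ler_norm (ip f g); have := cauchy_schwarz hf hg.
by rewrite -!L2norm_sqr; nra.
Qed.

Lemma L2normZ c f : L2 f -> nrm (fun x => c * f x) = `|c| * nrm f.
Proof.
move=> hf; rewrite /L2norm L2ipZl//; last exact: L2funZ.
rewrite L2ipC L2ipZl// mulrA -expr2 sqrtrM ?sqr_ge0// sqrtr_sqr//.
Qed.

End L2.

(** * The integral operator on square-integrable functions *)

(** A null set of the product has almost all its sections null, the measure of the
    product being the integral of the measures of the sections. *)
Lemma ae_prod d1 d2 (T1 : measurableType d1) (T2 : measurableType d2) (R : realType)
    (m1 : {sigma_finite_measure set T1 -> \bar R})
    (m2 : {sigma_finite_measure set T2 -> \bar R}) (P : T1 * T2 -> Prop) :
  {ae (m1 \x m2)%E, forall z, P z} ->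
  {ae m1, forall x, {ae m2, forall y, P (x, y)}}.
Proof.
move=> [A [mA A0 PA]].
have mxA : measurable_fun setT (m2 \o xsection A) by exact: measurable_fun_xsection.
have : (\int[m1]_(x in setT) `|(m2 \o xsection A) x| = 0)%E.
  by rewrite -[RHS]A0; apply: eq_integral => x _; rewrite gee0_abs.
move/(ae_eq_integral_abs m1 measurableT mxA); apply: filterS => x /= /(_ I) xA0.
exists (xsection A x); split => //; first exact: measurable_xsection.
by move=> y nP; rewrite /xsection /= inE; exact: PA.
Qed.

Section integral_operator.
Context {R : realType} {d : nat} (Omega : set 'rV[R]_d).
Hypotheses (mO : measurable Omega) (Oy : (leb d Omega < +oo)%E).
Local Notation L2 := (L2fun Omega).

Lemma L2fun_integrable f : L2 f -> rintegrable (leb d) Omega f.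
Proof.
move=> [mf f2]; apply: (@rintegrable_le _ _ _ _ _ mO _ (fun x => f x ^+ 2 + 1)) => //.
  by move=> x _; rewrite ler_norml; apply/andP; split; nra.
by apply: rintegrableD => //; exact: rintegrable_cst.
Qed.

(** For almost every x the kernel g x is bounded by M almost everywhere, so
    I f is bounded by M times the L1 norm of f; measurability is Fubini's theorem for f
    and g cut off outside Omega x Omega. *)
Lemma L2fun_Iop g f : Linfty2 Omega g -> L2 f -> L2 (Iop Omega g f).
Proof.
move=> [mg [M gM]] hf; have [mf _] := hf.
pose h : 'rV[R]_d * 'rV[R]_d -> R := (fun z => f z.2 * g z.1 z.2) \_ (Omega `*` Omega).
have mOO : measurable (Omega `*` Omega) by exact: measurableX.
have mh : measurable_fun setT h.
  apply: (measurable_restrictT _ mOO).1; apply: measurable_funM => //.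
  have msnd : measurable_fun (Omega `*` Omega) (@snd 'rV[R]_d 'rV[R]_d).
    by apply: measurable_funTS; exact: measurable_snd.
  by apply: (measurable_comp mO _ mf msnd) => _ [[x y] [_ Oy'] <-].
have hE x : Omega x -> (fun y => h (x, y)) = (fun y => f y * g x y) \_ Omega.
  move=> Ox; apply/funext => y; rewrite /h !patchE /=.
  by congr (if _ then _ else _); apply/idP/idP; rewrite !inE /= => // -[].
have h0 x y : ~ Omega x -> h (x, y) = 0.
  by move=> nOx; rewrite /h patchE memNset// => -[].
pose C : R := \int[leb d]_(y in Omega) `|f y|.
have intf : rintegrable (leb d) Omega (fun y => `|f y|).
  by apply: integrable_norm; exact: L2fun_integrable.
have CE : (\int[leb d]_(y in Omega) `|f y|%:E = C%:E)%E.
  by rewrite /C /Rintegral fineK//; exact: (integrable_fin_num _ intf).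
have C0 : 0 <= C by apply: Rintegral_ge0.
pose K : R := `|M| * C; have K0 : 0 <= K by rewrite mulr_ge0.
have mhx x : measurable_fun setT (fun y => `|(h (x, y))%:E|%E).
  apply: measurableT_comp => //; apply/measurable_EFinP.
  by apply: (measurableT_comp mh); exact: pair1_measurable.
have hK : {ae leb d, forall x, (\int[leb d]_y `|(h (x, y))%:E| <= (K * \1_Omega x)%:E)%E}.
  move: (ae_prod gM); apply: filterS => x gxM.
  have [Ox|nOx] := pselect (Omega x); last first.
    rewrite integral0_eq ?lee_fin ?mulr_ge0// => y _.
    by rewrite h0//= normr0.
  rewrite indicE mem_set// mulr1 EFinM -CE -ge0_integralZl//=; last first.
    by case/integrableP : intf.
  rewrite [leRHS]integral_mkcond; apply: ae_ge0_le_integral => //.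
  - exact: mhx.
  - by move=> y _; rewrite patchE; case: ifP.
  - apply: (measurable_restrictT _ mO).1; apply: emeasurable_funM => //.
    by case/integrableP : intf.
  - move: gxM; apply: filterS => y gxyM _.
    have /(congr1 (@^~ y)) /= -> := hE x Ox; rewrite !patchE; case: ifPn => yO /=.
      rewrite -EFinM lee_fin normrM mulrC ler_wpM2r// (le_trans _ (ler_norm M))//.
      by apply: gxyM; split => //; exact/set_mem.
    by rewrite normr0.
have ih : (leb d \x leb d)%E.-integrable setT (EFin \o h).
  apply/integrable12ltyP; first exact/measurable_EFinP.
  apply: (@le_lt_trans _ _ (\int[leb d]_x (K * \1_Omega x)%:E)%E).
    apply: ae_ge0_le_integral => //.
    - by move=> x _; exact: integral_ge0.
    - apply: (@measurable_fun_fubini_tonelli_F _ _ _ _ _ _ (fun z => `|(h z)%:E|%E)) => //.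
      by apply: measurableT_comp => //; exact/measurable_EFinP.
    - by move=> x _; rewrite lee_fin mulr_ge0.
    - by apply/measurable_EFinP; apply: measurable_funM => //; exact: measurable_indic.
    - by move: hK; apply: filterS.
  under eq_integral do rewrite EFinM.
  rewrite ge0_integralZl//=; last by apply/measurable_EFinP; exact: measurable_indic.
  by rewrite integral_indic// setIT lte_mul_pinfty.
pose F x := (\int[leb d]_y (h (x, y))%:E)%E.
have mF : measurable_fun setT F by exact: (measurable_fubini_F ih).
have IE x : Omega x -> Iop Omega g f x = fine (F x).
  move=> Ox; rewrite /Iop /Rintegral /F; congr fine.
  rewrite integral_mkcond; apply: eq_integral => y _.
  have /(congr1 (@^~ y)) /= -> := hE x Ox.
  by rewrite !patchE; case: ifP.
have mI : measurable_fun Omega (Iop Omega g f).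
  apply: (@eq_measurable_fun _ _ _ _ _ (fine \o F)).
    by move=> x /set_mem Ox; rewrite IE.
  by apply: measurable_funTS; apply: measurableT_comp.
split => //; apply/integrableP; split.
  by apply/measurable_EFinP; exact: measurable_funX.
apply: (@le_lt_trans _ _ (\int[leb d]_(x in Omega) (K ^+ 2)%:E)%E); last first.
  by rewrite integral_cst// lte_mul_pinfty// lee_fin sqr_ge0.
apply: ae_ge0_le_integral => //.
- by do 2 apply: measurableT_comp => //; exact: measurable_funX.
- by move=> x _; rewrite lee_fin sqr_ge0.
- move: hK; apply: filterS => x hx Ox.
  rewrite /= lee_fin normrX lerXn2r ?nnegrE// IE//.
  move: hx; rewrite indicE mem_set// mulr1 => hx.
  have : (`|F x| <= K%:E)%E.
    apply: le_trans hx; apply: le_abse_integral => //; apply/measurable_EFinP.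
    by apply: (measurableT_comp mh); exact: pair1_measurable.
  by case: (F x) => //=; rewrite normr0.
Qed.
End integral_operator.

(** * Energy estimate and stability *)

(** Summation by parts: the increases of the weights K enter with a minus sign
    against the nonnegative c_j. *)
Lemma weighted_increments_le (R : realDomainType) (K c : nat -> R) m : (0 < m)%N ->
  0 <= K 1%N -> (forall j, (0 < j < m)%N -> K j <= K j.+1) -> (forall j, 0 <= c j) ->
  \sum_(1 <= j < m.+1) K j * (c j - c j.-1) <= K m * c m.
Proof.
case: m => // m _ K1 Kmono c0; elim: m Kmono => [|m ih] Kmono.
  by rewrite big_nat1 /= ler_wpM2l// gerBl.
rewrite big_nat_recr//= -lerBrDr -mulrBr opprB addrC subrK.
apply: le_trans (ih _) _; first by move=> j /andP[j0 jm]; apply: Kmono; rewrite j0 ltnW.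
by apply: ler_wpM2r => //; apply: Kmono; rewrite leqnn.
Qed.

Lemma max_from_eq0 (R : realType) m n (F : nat -> R) : (m <= n)%N ->
  (forall i, (m <= i <= n)%N -> F i = 0) -> max_from m n F = 0.
Proof.
move=> mn F0; rewrite /max_from big_nat; elim/big_ind : _ => //.
- by rewrite F0// leqnn.
- by move=> x y -> ->; rewrite maxxx.
Qed.

Section energy.
Context {R : realType} {d : nat} (Omega : set 'rV[R]_d).
Hypothesis mO : measurable Omega.
Local Notation ip := (L2ip Omega).
Local Notation nrm := (L2norm Omega).
Local Notation L2 := (L2fun Omega).
Variables (alpha : R) (t : nat -> R).
Hypotheses (alpha01 : 0 < alpha < 1) (t0 : t 0%N = 0) (t_lt : forall i, t i < t i.+1).

(** The defects c_j = ||u_j|| ||u_n|| - (u_j, u_n) are nonnegative and vanish at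
    j = n, so their weighted increments sum to something nonpositive. *)
Lemma L1op_norm_le (u : nat -> 'rV[R]_d -> R) n : (0 < n)%N ->
  (forall i, (i <= n)%N -> L2 (u i)) ->
  nrm (u n) * (\sum_(1 <= j < n.+1) Kker alpha t n j * (nrm (u j) - nrm (u j.-1))) <=
  ip (L1op alpha t u n) (u n).
Proof.
move=> n0 hu; have hun := hu n (leqnn n).
pose c j := if (j <= n)%N then nrm (u j) * nrm (u n) - ip (u j) (u n) else 0.
have c0 j : 0 <= c j.
  rewrite /c; case: ifP => // jn; rewrite subr_ge0.
  by apply: le_trans (ler_norm _) _; apply: cauchy_schwarz => //; exact: hu.
have cn : c n = 0 by rewrite /c leqnn -L2norm_sqr expr2 subrr.
have jn_ j : j \in index_iota 1 n.+1 -> (0 < j <= n)%N by rewrite mem_index_iota ltnS.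
have := @weighted_increments_le R (Kker alpha t n) c n n0 _ _ c0.
rewrite cn mulr0 => /(_ _ _)/wrap[].
  by apply: Kker_ge0 => //; rewrite n0.
  by move=> j jn; apply: Kker_le.
rewrite -subr_ge0 sub0r -(@subr_ge0 _ _ (ip _ _)); congr (_ <= _).
rewrite /L1op L2ip_suml//; last first.
  move=> j /jn_ /andP[j0 jn]; apply: L2funZ => //; apply: L2funB => //; apply: hu => //.
  exact: leq_trans (leq_pred _) jn.
rewrite mulr_sumr -sumrN -sumrB big_nat [RHS]big_nat; apply: eq_bigr => j /andP[j0 jn].
have pn : (j.-1 <= n)%N by apply: leq_trans (leq_pred _) _.
have huj := hu j jn; have hup := hu _ pn.
rewrite L2ipZl//; last exact: L2funB.
have jn' : (j <= n)%N by [].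
by rewrite L2ipBl// /c jn' pn; ring.
Qed.

(** Sum of the absolute values of the extrapolation weights, for step ratios at
    most mu. *)
Definition extrap_const (s : scheme) (mu : R) : R :=
  match s with FullyImplicit => 1 | IMEX => 1 + 2 * mu end.

Lemma extrap_norm_le s (u : nat -> 'rV[R]_d -> R) n mu M : (0 < n)%N -> 0 <= mu ->
  (forall m, (1 < m <= n)%N -> 0 <= tratio t m <= mu) ->
  (forall i, (i <= n)%N -> L2 (u i)) -> (forall i, (i <= n)%N -> nrm (u i) <= M) ->
  L2 (extrap s t u n) /\ nrm (extrap s t u n) <= extrap_const s mu * M.
Proof.
move=> n0 mu0 hr hu uM; have M0 : 0 <= M by apply: le_trans (uM n _); rewrite ?L2norm_ge0.
case: s => /=; first by rewrite mul1r; split; [exact: hu|exact: uM].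
case: n n0 hr hu uM => // -[_ _|n _ hr] hu uM.
  split; first exact: hu.
  by apply: le_trans (uM 0%N _) _ => //; nra.
have /andP[r0 rle] := hr n.+2 (leqnn _); set r := tratio t n.+2 in r0 rle *.
have h1 := hu n.+1 (leqnSn _); have h2 := hu n (leq_trans (leqnSn _) (leqnSn _)).
have hr1 := L2funZ mO (1 + r) h1; have hr2 := L2funZ mO (- r) h2.
have -> : (fun x => (1 + r) * u n.+1 x - r * u n x) =
    (fun x => (1 + r) * u n.+1 x + (- r) * u n x) by apply/funext => x; rewrite mulNr.
split; first exact: L2funD.
apply: le_trans (L2norm_triangle mO hr1 hr2) _.
rewrite !L2normZ// normrN !ger0_norm//; last by rewrite addr_ge0.
have := uM n.+1 (leqnSn _); have := uM n (leq_trans (leqnSn _) (leqnSn _)).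
move: (nrm _) (nrm _) => p q; nra.
Qed.
End energy.

Section scalar.
Context {R : realType}.

(** Completing the square in the H1 norm x. *)
Lemma coercive_lower_bound (b0 b1 x y p q : R) : 0 < b0 ->
  b0 * x ^+ 2 <= p -> `|q| <= b1 * x * y -> - (b1 ^+ 2 / b0 / 4 * y ^+ 2) <= p + q.
Proof.
move=> b00 hp; rewrite ler_norml => /andP[hq _].
have : 0 <= b0 * (x - b1 / b0 / 2 * y) ^+ 2 by rewrite mulr_ge0 ?sqr_ge0// ltW.
have -> : b0 * (x - b1 / b0 / 2 * y) ^+ 2 =
    b0 * x ^+ 2 - b1 * x * y + b1 ^+ 2 / b0 / 4 * y ^+ 2 by field; rewrite gt_eqF.
lra.
Qed.

(** The factor y of every term is divided out.  The quarter of b lost in the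
    bilinear form is rounded up to a half so that the two contributions add up to half
    of the constant of the theorem. *)
Lemma energy_absorb (y D b l k e M F S a I H : R) :
  0 < y -> y <= M -> 0 <= b -> 0 <= k ->
  y * D <= S -> S + a = l * I + H -> - (b / 4 * y ^+ 2) <= a ->
  `|I| <= k * (e * M) * y -> `|H| <= F * y ->
  D <= (b + 2 * (`|l| * e * k)) / 2 * M + F.
Proof.
move=> y0 yM b0 k0 hD hS ha hI hH.
rewrite -(ler_pM2l y0); apply: le_trans hD _.
have -> : S = l * I + H - a by rewrite -hS addrK.
have h1 : l * I <= `|l| * (k * (e * M) * y).
  by apply: le_trans (ler_norm _) _; rewrite normrM ler_wpM2l.
have h2 := ler_norm H.
have h3 : b / 4 * y ^+ 2 <= b / 2 * M * y.
  rewrite expr2 mulrA ler_pM2r//; nra.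
rewrite [leRHS](_ : _ = b / 2 * M * y + `|l| * (k * (e * M) * y) + F * y); last by field.
lra.
Qed.
End scalar.

Theorem theorem3p2 (R : realType) (d : nat) (Omega : set 'rV[R]_d)
  (alpha T lambda gamma beta0 beta1 beta2 : R) (N : nat)
  (A : 'rV[R]_d -> R -> 'M[R]_d) (b : 'rV[R]_d -> R -> 'rV[R]_d)
  (c : 'rV[R]_d -> R -> R) (g : 'rV[R]_d -> 'rV[R]_d -> R)
  (u0 : 'rV[R]_d -> R) (f : 'rV[R]_d -> R -> R)
  (Sh : set ('rV[R]_d -> R)) (s : scheme) (uh : nat -> 'rV[R]_d -> R)
  (hd : (1 <= d <= 3)%N) (hOmega : convex_polytope_domain Omega)
  (halpha : 0 < alpha < 1) (hT : 0 < T) (hgamma : 1 <= gamma) (hN : (1 < N)%N)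
  (hAsym : forall x t, Omega x -> `]0, T]%classic t -> (A x t)^T = A x t)
  (hApos : exists2 a : R, 0 < a &
     forall x t (xi : 'rV[R]_d), Omega x -> `]0, T]%classic t ->
       a * dotv xi xi <= dotv (xi *m (A x t)^T) xi)
  (hAbd : forall i j, bounded_coef Omega `]0, T] (fun x t => A x t i j))
  (hAder : forall i j x t, Omega x -> `]0, T[%classic t ->
     derivable (fun r => A x r i j) t 1)
  (hAderbd : forall i j,
     bounded_coef Omega `]0, T[ (fun x t => derive1 (fun r => A x r i j) t))
  (hbbd : forall i, bounded_coef Omega `]0, T] (fun x t => b x t ord0 i))
  (hcbd : bounded_coef Omega `]0, T] c)
  (hbeta0 : 0 < beta0) (hbeta1 : 0 < beta1)
  (ha0 : forall t phi, `]0, T]%classic t -> H10fun Omega phi ->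
     beta0 * H1norm Omega phi ^+ 2 <= a0form Omega A t phi phi)
  (ha1 : forall t phi psi, `]0, T]%classic t ->
     H10fun Omega phi -> H10fun Omega psi ->
     `|a1form Omega b c t phi psi| <=
       beta1 * H1norm Omega phi * L2norm Omega psi)
  (hg : Linfty2 Omega g)
  (hbeta2 : forall phi, L2fun Omega phi ->
     L2norm Omega (Iop Omega g phi) <= beta2 * L2norm Omega phi)
  (tm := mesh T gamma N)
  (a := fun t phi psi => a0form Omega A t phi psi + a1form Omega b c t phi psi)
  (fm := fun n : nat => fun x => f x (tm n))
  (hSh : fin_dim_subspace Omega Sh)
  (hu0 : L2fun Omega u0)
  (hf : forall n, (1 <= n <= N)%N -> L2fun Omega (fm n))
  (Lambda := Lambda0 s beta0 beta1 beta2 lambda (max_from 2 N (tratio tm)))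
  (hdt : max_from 1 N (tstep tm) <
     (1 / (2 * Lambda * Gamma (2 - alpha))) `^ (1 / alpha))
  (huh0 : is_L2proj Omega Sh u0 (uh 0%N))
  (huhS : forall n, (1 <= n <= N)%N -> Sh (uh n))
  (huh : forall n, (1 <= n <= N)%N -> forall vh, Sh vh ->
     L2ip Omega (L1op alpha tm uh n) vh + a (tm n) (uh n) vh =
     lambda * L2ip Omega (Iop Omega g (extrap s tm uh n)) vh +
     L2ip Omega (fm n) vh) :
  forall n, (1 <= n <= N)%N ->
    L2norm Omega (uh n) <=
      2 * C0 R * mittag_leffler alpha (2 * Lambda * tm n `^ alpha) *
      (L2norm Omega (uh 0%N) +
       max_from 1 n (fun j =>
         \sum_(1 <= i < j.+1) Pker alpha tm j i * L2norm Omega (fm i))).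
Proof.
have mO := measurable_polytope hOmega.
have Oy : (leb d Omega < +oo)%E by apply: leb_bounded => //; case: hOmega.
have t0 : tm 0%N = 0 by exact: mesh0.
have t_lt : forall i, tm i < tm i.+1 by exact: mesh_increasing.
have t_step : forall i, (0 < i)%N -> tstep tm i <= tstep tm i.+1 by exact: mesh_tstep_le.
have tN : tm N = T by exact: meshN.
(* From here on tm is any mesh that starts at 0 with nondecreasing positive steps. *)
clearbody tm.
have tmT m : (1 <= m <= N)%N -> `]0, T]%classic (tm m).
  move=> /andP[m0 mN]; rewrite /= in_itv /= (mesh_gt0 t0 t_lt m0) /= -tN.
  exact: (mesh_le t_lt).
have SH m : (m <= N)%N -> H10fun Omega (uh m).
  move=> mN; apply: hSh.1; case: m mN => [_|m mN]; first exact: huh0.1.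
  exact: huhS.
have Lu m : (m <= N)%N -> L2fun Omega (uh m) by move=> /SH [[]].
move=> n /andP[n0 nN].
(* A negative beta2 makes every norm vanish, and both sides with it; the sign of Lambda
   is then unknown. *)
have [b0|b0] := ltP beta2 0.
  have z phi : L2fun Omega phi -> L2norm Omega phi = 0.
    move=> /hbeta2 h; apply/eqP; rewrite eq_le L2norm_ge0 andbT.
    have := L2norm_ge0 Omega (Iop Omega g phi); nra.
  rewrite (z _ (Lu n nN)) (z _ (Lu 0%N (leq0n _))) max_from_eq0 ?addr0 ?mulr0//.
  move=> j /andP[j1 jn]; rewrite big_nat big1// => i /andP[i1 ij].
  have iN : (1 <= i <= N)%N by rewrite i1 (leq_trans _ (leq_trans jn nN)).
  by rewrite (z _ (hf i iN)) mulr0.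
have alpha0 : 0 < alpha by case/andP: halpha.
pose mu := max_from 2 N (tratio tm).
have ratio_le m : (1 < m <= N)%N -> 0 <= tratio tm m <= mu.
  move=> m1N; rewrite (tratio_ge0 t_lt) ?le_max_from//; by case/andP: m1N.
have mu0 : 0 <= mu by have /andP[r0] := ratio_le 2 hN; exact: le_trans.
pose e := extrap_const s mu.
have e0 : 0 <= e by rewrite /e /extrap_const; case: (s) => //; lra.
have LE : Lambda = beta1 ^+ 2 / beta0 + 2 * (`|lambda| * e * beta2).
  by rewrite /Lambda /Lambda0 /e /extrap_const -/mu; case: (s); ring.
have B0 : 0 < beta1 ^+ 2 / beta0 by rewrite divr_gt0// exprn_gt0.
have L0 : 0 < Lambda by rewrite LE ltr_wpDr// !mulr_ge0.
have hK m : (0 < m <= n)%N -> 2 * Lambda <= Kker alpha tm m m.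
  move=> /andP[m0 mn]; apply: Kker_diag_ge => //; apply: le_lt_trans hdt.
  by apply: le_max_from; rewrite m0 (leq_trans mn).
pose y i := L2norm Omega (uh i).
have y0 i : 0 <= y i by exact: L2norm_ge0.
have hD m M : (0 < m <= n)%N -> (forall i, (i <= m)%N -> y i <= M) ->
    \sum_(1 <= j < m.+1) Kker alpha tm m j * (y j - y j.-1) <=
    Lambda / 2 * M + L2norm Omega (fm m).
  move=> /andP[m0 mn] yM; have mN := leq_trans mn nN; have m0N : (1 <= m <= N)%N by rewrite m0.
  have M0 : 0 <= M by apply: le_trans (yM m _).
  have F0 := L2norm_ge0 Omega (fm m).
  have Lm i : (i <= m)%N -> L2fun Omega (uh i) by move=> im; exact/Lu/(leq_trans im).
  have [LEu nEu] : L2fun Omega (extrap s tm uh m) /\ L2norm Omega (extrap s tm uh m) <= e * M.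
    apply: extrap_norm_le => // i /andP[i1 im]; apply: ratio_le.
    by rewrite i1 (leq_trans im).
  have LI := L2fun_Iop mO Oy hg LEu.
  (* When y m = 0 there is no factor to divide out, but then the left side is
     nonpositive by summation by parts. *)
  have [ym0|ym0] := eqVneq (y m) 0.
    have := @weighted_increments_le R (Kker alpha tm m) y m m0 _ _ y0; rewrite ym0 mulr0 => h.
    apply: le_trans (h _ _) _.
    - by apply: Kker_ge0 => //; rewrite m0.
    - by move=> j jm; apply: Kker_le.
    - by rewrite addr_ge0// mulr_ge0// divr_ge0// ltW.
  have ymp : 0 < y m by rewrite lt_neqAle eq_sym ym0 y0.
  rewrite LE; apply: (energy_absorb ymp (yM m (leqnn m)) (ltW B0) b0).
  - exact: (L1op_norm_le mO halpha t0 t_lt m0 Lm).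
  - exact: huh m m0N _ (huhS m m0N).
  - apply: coercive_lower_bound => //.
    + exact: ha0 (tmT m m0N) (SH m mN).
    + exact: ha1 (tmT m m0N) (SH m mN) (SH m mN).
  - apply: le_trans (cauchy_schwarz mO LI (Lu m mN)) _.
    rewrite -/(y m); apply: ler_wpM2r; first exact: y0.
    by apply: le_trans (hbeta2 _ LEu) _; apply: ler_wpM2l.
  - exact: (cauchy_schwarz mO (hf m m0N) (Lu m mN)).
set Fs := fun j => _.
have Fs0 j : (j <= n)%N -> 0 <= Fs j.
  move=> jn; rewrite /Fs big_nat sumr_ge0// => i ij; rewrite mulr_ge0 ?L2norm_ge0//.
  exact: Pker_ge0.
have maxF j : (0 < j <= n)%N -> Fs j <= max_from 1 n Fs by move=> ?; exact: le_max_from.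
have max0 : 0 <= max_from 1 n Fs by apply: le_trans (maxF n _); rewrite ?n0 ?leqnn// Fs0.
have z0 m : 0 <= 2 * Lambda * tm m `^ alpha by rewrite mulr_ge0 ?powR_ge0// mulr_ge0// ltW.
set G := _ + max_from 1 n Fs.
have G0 : 0 <= G by rewrite addr_ge0// L2norm_ge0.
have LL0 : 0 <= 2 * Lambda by rewrite mulr_ge0// ltW.
pose E m := mittag_leffler alpha (2 * Lambda * tm m `^ alpha).
have E1 m : 1 <= E m by exact: mittag_leffler_ge1.
apply: (@le_trans _ _ (2 * G * E n)).
  apply: (@discrete_gronwall _ _ _ halpha t0 t_lt Lambda G y
    (fun i => L2norm Omega (fm i)) E n L0 y0 E1 _ _ hK hD) => //.
  - move=> i m im; apply: le_mittag_leffler => //; rewrite z0 ler_wpM2l//.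
    by apply: ge0_ler_powR; rewrite ?nnegrE ?(mesh_ge0 t0 t_lt) ?(mesh_le t_lt)// ltW.
  - move=> m m0; exact: Pker_mittag_leffler.
  - by rewrite lerDl.
  - by move=> m mn; rewrite lerD2l; exact: maxF.
rewrite -/(E n) /C0; have := E1 n; nra.
Qed.
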